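(* Let $p$ be an odd prime, $n\ge1$, and $M=Ap^n+w_n$ with integers $0<A<p^n$, $0<w_n<p^n$, $w_n^{p-1}\equiv1\pmod{p^n}$. Let $\pi\in\mathcal O_L$ be coprime to $M$ with $\left(\frac{\pi}{M}\right)_p\neq1$, and let $\tau$, $T_k^{(m)}$, $U^{(m)}$ be as in the context. Suppose further that $M$ is not divisible by any integer $x$ with $1<x<p^n$ and $x^{p-1}\equiv1\pmod{p^n}$. Then the following are equivalent: (i) $M$ is prime; (ii) there exists a primitive $p$-th root of unity $\xi$ such that $\tau^{p^{n-1}}\equiv\xi\pmod M$; (iii) $T_{n-1}^{(m)}\equiv U^{(m)}\pmod M$ for each $m=1,\dots,r$.
   Context: Let $\zeta=e^{2\pi\sqrt{-1}/p}$, $L=\mathbb{Q}(\zeta)$, $\mathcal O_L=\mathbb{Z}[\zeta]$, $K=\mathbb{Q}(\zeta+\zeta^{-1})$, $r=(p-1)/2$, $G=\mathrm{Gal}(L/\mathbb{Q})$, and for $c$ prime to $p$ let $\sigma_c\in G$ send $\zeta\mapsto\zeta^c$. For $\delta=\sum_{\sigma}k_\sigma\sigma\in\mathbb{Z}[G]$ and $0\neq\alpha\in L$, $\alpha^\delta=\prod_\sigma\sigma(\alpha)^{k_\sigma}$. A bar denotes $\sigma_{-1}$. Power residue symbol: for a prime ideal $\mathfrak P\nmid p$ of $\mathcal O_L$ and $\alpha\in\mathcal O_L\setminus\mathfrak P$, $\left(\frac{\alpha}{\mathfrak P}\right)_p$ is the unique $p$-th root of unity congruent to $\alpha^{(|\mathcal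 O_L/\mathfrak P|-1)/p}$ modulo $\mathfrak P$ (and $0$ if $\alpha\in\mathfrak P$); it is extended multiplicatively to ideals prime to $p$, and $\left(\frac{\alpha}{M}\right)_p:=\left(\frac{\alpha}{M\mathcal O_L}\right)_p$. Let $f$ be the order of $M$ mod $p$, $H=\{\sigma_{M^j}:0\le j<f\}$, $g=(p-1)/f$, $\Phi_d$ the $d$-th cyclotomic polynomial. If $f$ is odd, choose integers $S=\{i_1,\dots,i_{g/2}\}$ with $\{\sigma_{i_s}\}$ a set of representatives of $G/\langle\sigma_{-1}\rangle H$ and let $\gamma=\sum_{i\in S}i(\sigma_i^{-1}-\sigma_{-i}^{-1})$; if $f$ is even, choose integers $T=\{j_1,\dots,j_g\}$ with $\{\sigma_{j_t}\}$ a set of representatives of $G/H$ and let $\gamma=\sum_{j\in T}j\sigma_j^{-1}$. Put $\tau=\pi^{\gamma\prod_{d\mid f,d<f}\Phi_d(\sigma_M)\cdot\Phi_f(M)/p^n}$ (here $p^n\mid\Phi_f(M)$), $t_k=\tau^{p^k}+\bar\tau^{p^k}$, $T_k^{(m)}=\sum_{1\le i_1<\dots<i_m\le r}\prod_{j=1}^m t_k^{\sigma_{i_j}}\in\mathbb{Q}$. For a primitive $p$-th root of unity $\xi$, $U^{(m)}=\sum_{1\le i_1<\dots<i_m\le r}\prod_{j=1}^m\sigma_{i_j}(\xi+\bar\xi)\in\mathbb{Q}$, which does not depend on $\xi$ (equivalently, $(-1)^mU^{(m)}$ is the coefficient of $z^{r-m}$ in the minimal polynomial of $\xi+\xi^{-1}$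 over $\mathbb{Q}$). Congruences modulo $M$: $\tau$, $t_k$, $T_k^{(m)}$ lie in the localization of $\mathcal O_L$ at the complement of the union of the primes above $M$ (since $\pi$ is coprime to $M$); for such elements $a,b$, $a\equiv b\pmod M$ means that $a,b$ have the same image in $\mathcal O_L/M\mathcal O_L$ (for rational numbers with denominators prime to $M$, this is congruence in $\mathbb{Z}/M\mathbb{Z}$). *)

(* Defs.v *)
From HB Require Import structures.
From mathcomp Require Import all_boot all_order all_algebra.
From mathcomp Require Import all_fingroup all_solvable all_field.
From mathcomp Require Import ring_quotient boolp.

Set Implicit Arguments.
Unset Strict Implicit.
Unset Printing Implicit Defensive.

Import GRing.Theory Num.Theory.
Local Open Scope ring_scope.

(* The integral group ring Z[G] of a finite group. It is a new name for
   {ffun gT -> int} because the product is the convolution, not the pointwise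
   product that {ffun gT -> int} already carries. *)
Definition int_group_ring (gT : finGroupType) : Type := {ffun gT -> int}.

Section GroupRing.

Variable gT : finGroupType.

HB.instance Definition _ := GRing.Zmodule.copy (int_group_ring gT) {ffun gT -> int}.

Implicit Types x y z : {ffun gT -> int}.

Definition igring_elt (g : gT) : int_group_ring gT := [ffun h => (h == g)%:R].

Definition igring_mul (x y : int_group_ring gT) : int_group_ring gT :=
  [ffun g => \sum_(h : gT) (x : {ffun gT -> int}) h *
                           (y : {ffun gT -> int}) (h^-1 * g)%g].

Fact igring_mulA : associative igring_mul.
Proof.
move=> x y z; apply/ffunP => g; rewrite !ffunE.
under eq_bigr => h _ do rewrite ffunE mulr_sumr.
under [RHS]eq_bigr => h _ do rewrite ffunE mulr_suml.
rewrite [RHS]exchange_big /=; apply: eq_bigr => h _.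
rewrite (reindex_inj (mulgI h^-1%g)) /=; apply: eq_bigr => k _.
by rewrite mulrA invMg invgK -!mulgA mulKVg.
Qed.

Fact igring_mul1l : left_id (igring_elt 1) igring_mul.
Proof.
move=> x; apply/ffunP => g; rewrite ffunE (bigD1 1%g) //= ffunE eqxx mul1r.
rewrite invg1 mul1g big1 ?addr0 // => h /negPf h1.
by rewrite ffunE h1 mul0r.
Qed.

Fact igring_mul1r : right_id (igring_elt 1) igring_mul.
Proof.
move=> x; apply/ffunP => g; rewrite ffunE (bigD1 g) //= ffunE mulVg eqxx mulr1.
rewrite big1 ?addr0 // => h hg; rewrite ffunE -eq_mulVg1.
by rewrite (negPf hg) mulr0.
Qed.

Fact igring_mulDl : left_distributive igring_mul +%R.
Proof.
move=> x y z; apply/ffunP => g; rewrite !ffunE -big_split /=.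
by apply: eq_bigr => h _; rewrite ffunE mulrDl.
Qed.

Fact igring_mulDr : right_distributive igring_mul +%R.
Proof.
move=> x y z; apply/ffunP => g; rewrite !ffunE -big_split /=.
by apply: eq_bigr => h _; rewrite ffunE mulrDr.
Qed.

Fact igring_1_neq0 : igring_elt 1 != 0 :> int_group_ring gT.
Proof. by apply/eqP => /ffunP/(_ 1%g)/eqP; rewrite !ffunE eqxx oner_eq0. Qed.

HB.instance Definition _ := GRing.Zmodule_isNzRing.Build (int_group_ring gT)
  igring_mulA igring_mul1l igring_mul1r igring_mulDl igring_mulDr igring_1_neq0.

End GroupRing.

Section Ideals.

Variable R : comNzRingType.

Definition ideal_mul (I J : R -> Prop) (x : R) : Prop :=
  exists s : seq (R * R),
    (forall u, u \in s -> I u.1 /\ J u.2) /\ x = \sum_(u <- s) u.1 * u.2.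

Definition unit_ideal (x : R) : Prop := True.

Definition principal_ideal (a x : R) : Prop := exists y, x = a * y.

Definition residue_card (P : prime_idealr R) (q : nat) : Prop :=
  exists h : 'I_q -> {ideal_quot P}, bijective h.

(* prime_power_residue p P a s : the p-th power residue symbol (a / P)_p is
   defined and its value is s. *)
Definition prime_power_residue (p : nat) (P : prime_idealr R) (a s : R) : Prop :=
  p%:R \notin (P : {pred R}) /\
  if a \in (P : {pred R}) then s = 0
  else exists2 q, residue_card P q &
         s ^+ p = 1 /\
         (a ^+ ((q - 1) %/ p) = s %[ mod_ideal P])%qT.

(* power_residue p I a s : the symbol (a / I)_p, obtained by multiplicativity
   from a factorization of I into prime ideals not above p, has value s. *)
Definition power_residue (p : nat) (I : R -> Prop) (a s : R) : Prop :=
  exists k (P : 'I_k -> prime_idealr R) (c : 'I_k -> R),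
    [/\ forall x, I x <->
          (\big[ideal_mul/unit_ideal]_(i < k) (fun y => y \in (P i : {pred R}))) x,
        forall i, prime_power_residue p (P i) a (c i)
      & s = \prod_(i < k) c i].

End Ideals.

Section IntegerRing.

Variables (L : fieldExtType rat) (zeta : L).

Definition Zadjoin : {pred L} :=
  fun x => `[< exists q : {poly int}, x = (map_poly intr q).[zeta] >].

Fact Zadjoin_subring_closed : subring_closed Zadjoin.
Proof.
split=> [|x y|x y].
- by apply/asboolP; exists 1; rewrite rmorph1 hornerC.
- move=> /asboolP[q ->] /asboolP[r ->]; apply/asboolP; exists (q - r).
  by rewrite rmorphB hornerD hornerN.
- move=> /asboolP[q ->] /asboolP[r ->]; apply/asboolP; exists (q * r).
  by rewrite rmorphM hornerM.
Qed.

HB.instance Definition _ :=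
  GRing.isSubringClosed.Build L Zadjoin Zadjoin_subring_closed.

Definition Zring : Type := {x : L | x \in Zadjoin}.

HB.instance Definition _ := [isSub of Zring for @proj1_sig L _].
HB.instance Definition _ := [Choice of Zring by <:].
HB.instance Definition _ := [SubChoice_isSubComNzRing of Zring by <:].

(* The class of c in Zring / M Zring is the image of x, where x belongs to the
   localization of Zring at the complement of the union of the primes above
   M. *)
Definition reduces_to (M : nat) (x : L) (c : Zring) : Prop :=
  exists y s : Zring,
    [/\ forall P : prime_idealr Zring,
          M%:R \in (P : {pred Zring}) -> s \notin (P : {pred Zring}),
        x = val y / val s
      & principal_ideal M%:R (y - c * s)].

Definition congr_mod (M : nat) (x y : L) : Prop :=
  exists2 c : Zring, reduces_to M x c & reduces_to M y c.

End IntegerRing.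

Section Cyclotomic.

Variables (L : splittingFieldType rat) (zeta : L).

Local Notation galT := (gal_of {:L}).
Local Notation G := ('Gal({:L} / 1))%g.

(* sigma c maps zeta to zeta ^ c when c is prime to the order of zeta; otherwise
   it may be the default value 1, so uses must require coprimality. *)
Definition sigma (c : int) : galT :=
  odflt 1%g [pick s : galT | s zeta == zeta ^ c].

Definition bar (x : L) : L := sigma (-1) x.

Definition gexp (a : L) (delta : int_group_ring galT) : L :=
  \prod_(s : galT) (s a) ^ ((delta : {ffun galT -> int}) s).

Definition subH (M f : nat) : {set galT} :=
  [set sigma (M%:Z ^+ j) | j : 'I_f].

Definition coset_reps (p k : nat) (N : {set galT}) (S : seq int) : Prop :=
  [/\ size S = k, all (fun i => coprimez i p%:Z) S
    & is_transversal [set s in [seq sigma i | i <- S]] (rcosets N G) G].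

(* S plays the role of the index set called S for f odd, and T for f even. *)
Definition gamma_reps (p M f : nat) (S : seq int) : Prop :=
  let g := (p.-1 %/ f)%N in
  if odd f then coset_reps p (g %/ 2) (<[sigma (-1)]> * subH M f)%g S
  else coset_reps p g (subH M f) S.

Definition gamma (f : nat) (S : seq int) : int_group_ring galT :=
  if odd f then
    \sum_(i <- S) (igring_elt (sigma i)^-1%g - igring_elt (sigma (- i))^-1%g) *~ i
  else \sum_(j <- S) igring_elt (sigma j)^-1%g *~ j.

Definition tau_exponent (p n M f : nat) (S : seq int) : int_group_ring galT :=
  (gamma f S *
   \prod_(d <- divisors f | (d < f)%N)
      (map_poly intr 'Phi_d).[igring_elt (sigma M%:Z)])
  *~ (('Phi_f).[M%:Z] %/ (p ^ n)%N%:Z)%Z.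

Definition tau (p n M f : nat) (S : seq int) (a : Zring zeta) : L :=
  gexp (val a) (tau_exponent p n M f S).

Definition t_ (p n M f : nat) (S : seq int) (a : Zring zeta) (k : nat) : L :=
  tau p n M f S a ^+ (p ^ k) + bar (tau p n M f S a) ^+ (p ^ k).

(* The m-th elementary symmetric function of sigma_1 x, ..., sigma_r x,
   r = (p - 1) / 2. *)
Definition conj_esym (p : nat) (x : L) (m : nat) : L :=
  \sum_(I : {set 'I_(p.-1 %/ 2)} | #|I| == m)
     \prod_(i in I) (sigma i.+1%:Z) x.

Definition T_ (p n M f : nat) (S : seq int) (a : Zring zeta) (k m : nat) : L :=
  conj_esym p (t_ p n M f S a k) m.

(* U^(m) is independent of the primitive p-th root of unity; zeta is used. *)
Definition U_ (p m : nat) : L := conj_esym p (zeta + bar zeta) m.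

End Cyclotomic.

(* Main.v *)
(** Every ring morphism from O = Z[zeta] to a field of characteristic M (or of
a prime divisor of M) is phi o s for a fixed phi and some s in Gal(L/Q), so
the ideals above M are studied through these morphisms only.

(i) => (ii).  Since sigma_M acts modulo M as the M-th power, tau^(p^(n-1)) is
congruent to pi^(gamma N) with N = (M^f - 1)/p.  The element pi^N reduces at
each prime P above M to the power residue symbol (pi/P), and the coefficient j
of sigma_j^-1 in gamma moves the symbols at all the conjugates of P to the
same place, where their product is (pi/M).  To compare that product with the
one given by a factorization of (M), without matching primes and cosets, both
are written as roots of the product over all of Gal(L/Q): their 2f-th powers
agree, and 2f is prime to p.

(ii) => (iii) is reduction of symmetric functions, which do not depend on xi.

(iii) => (i).  The exponent of tau is killed by 1 + sigma_{-1}, so tau times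
its conjugate is 1.  In a field of characteristic q | M, equality of the
symmetric functions makes z + 1/z = w + 1/w with z the image of tau^(p^(n-1))
and w a primitive p-th root of unity; hence z = w or z = 1/w, and tau has
order exactly p^n there.  As x^(q^(p-1)) = x on the image of O, p^n divides
q^(p-1) - 1, so that q >= p^n; since M < p^(2n), M is prime. *)
From HB Require Import structures.
Require Import Defs.
From mathcomp Require Import all_boot all_order all_algebra.
From mathcomp Require Import all_fingroup all_solvable all_field.
From mathcomp Require Import ring_quotient boolp.
From mathcomp Require Import zify ring.

Set Implicit Arguments.
Unset Strict Implicit.
Unset Printing Implicit Defensive.

Import Order.TTheory GRing.Theory Num.Theory.
Local Open Scope ring_scope.

(** * Exponents in the integral group ring *)

Section MultiplicativeAction.

Variables (gT : finGroupType) (K : fieldType).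
Implicit Types (F : gT -> K) (x y : int_group_ring gT).

(** Extends [gexp] to arbitrary families in a field, so that one exponent acts both on the
    conjugates of an element of [L] and on their reductions. *)
Definition pexp F (d : int_group_ring gT) : K :=
  \prod_(g : gT) F g ^ (d : {ffun gT -> int}) g.

Lemma eq_pexp F1 F2 x : F1 =1 F2 -> pexp F1 x = pexp F2 x.
Proof. by move=> eF; apply: eq_bigr => g _; rewrite eF. Qed.

Lemma pexp_unit F x : (forall g, F g != 0) -> pexp F x != 0.
Proof. by move=> F0; apply/prodf_neq0 => g _; apply: expfz_neq0. Qed.

Lemma pexp0 F : pexp F 0 = 1.
Proof. by apply: big1 => g _; rewrite ffunE expr0z. Qed.

Lemma pexpD F x y : (forall g, F g != 0) -> pexp F (x + y) = pexp F x * pexp F y.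
Proof.
move=> F0; rewrite /pexp -big_split; apply: eq_bigr => g _.
by rewrite ffunE expfzDr.
Qed.

Lemma pexp_sum F (I : Type) (r : seq I) (P : pred I) (X : I -> int_group_ring gT) :
  (forall g, F g != 0) ->
  pexp F (\sum_(i <- r | P i) X i) = \prod_(i <- r | P i) pexp F (X i).
Proof.
move=> F0; elim/big_rec2: _ => [|i u v _ <-]; first exact: pexp0.
exact: pexpD.
Qed.

Lemma igring_mulrzE x (k : int) g :
  (x *~ k : {ffun gT -> int}) g = (x : {ffun gT -> int}) g * k.
Proof.
case: k => k; rewrite ?NegzE ?mulrNz -pmulrn ?ffunE ffunMnE -mulr_natr natz //.
by rewrite mulrN.
Qed.

Lemma pexp_mulrz F x k : pexp F (x *~ k) = pexp F x ^ k.
Proof.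
rewrite /pexp; under eq_bigr => g _ do rewrite igring_mulrzE -exprz_exp.
case: k => k; first by rewrite -exprnP -prodrXl; apply: eq_bigr => g _; rewrite -exprnP.
rewrite NegzE -exprnN -prodrXl -prodfV; apply: eq_bigr => g _.
by rewrite -exprnN.
Qed.

Lemma pexp_elt F h : pexp F (igring_elt h) = F h.
Proof.
rewrite /pexp (bigD1 h) //= ffunE eqxx expr1z big1 ?mulr1 // => g /negPf gh.
by rewrite ffunE gh expr0z.
Qed.

(** Convolution becomes iterated exponentiation after the substitution [g = h t]: the inner factor
    [y] acts on the left translates of [F], the outer factor [x] on the results. *)
Lemma pexp_mul F x y : (forall g, F g != 0) ->
  pexp F (x * y) = pexp (fun s => pexp (fun t => F (s * t)%g) y) x.
Proof.
move=> F0; rewrite /pexp.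
transitivity (\prod_g \prod_h
  F g ^ ((x : {ffun gT -> int}) h * (y : {ffun gT -> int}) (h^-1 * g)%g)).
  apply: eq_bigr => g _; rewrite ffunE.
  elim: (index_enum _) => [|h r IH]; first by rewrite !big_nil expr0z.
  by rewrite !big_cons expfzDr // IH.
rewrite exchange_big /=; apply: eq_bigr => h _.
rewrite (reindex_inj (mulgI h)) /=.
elim: (index_enum _) => [|g r IH]; first by rewrite !big_nil exp1rz.
rewrite !big_cons IH mulKg; rewrite expfzMl; congr (_ * _).
by rewrite mulrC -exprz_exp.
Qed.

End MultiplicativeAction.

Lemma igring_elt1 (gT : finGroupType) : igring_elt (1%g : gT) = 1.
Proof. by []. Qed.

Lemma igring_eltM (gT : finGroupType) (g h : gT) :
  igring_elt g * igring_elt h = igring_elt (g * h)%g.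
Proof.
apply/ffunP => k; rewrite !ffunE (bigD1 g) //= !ffunE eqxx mul1r.
rewrite big1 ?addr0 => [|j /negPf jg]; last by rewrite !ffunE jg mul0r.
by rewrite -(inj_eq (mulgI g)) mulKVg.
Qed.

Lemma igring_mulC (gT : finGroupType) (x y : int_group_ring gT) :
  (forall g h : gT, commute g h) -> x * y = y * x.
Proof.
move=> cG; apply/ffunP => g; rewrite !ffunE.
rewrite (reindex_inj invg_inj) (reindex_inj (mulgI g^-1%g)) /=.
by apply: eq_bigr => h _; rewrite !invMg !invgK mulrC -[(g^-1 * h * g)%g]mulgA (cG h g) mulKg.
Qed.

(** Frobenius modulo [q], with the multiple of [q] explicit so that [R] may have any characteristic:
    Fermat fixes the coefficients modulo [q], and [q] divides the middle binomial coefficients. *)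
Lemma horner_intr_exp (R : comNzRingType) (q : nat) (u : {poly int}) (z : R) :
  prime q -> exists v : R,
    (map_poly intr u).[z] ^+ q = (map_poly intr u).[z ^+ q] + v * q%:R.
Proof.
move=> pq; elim/poly_ind: u => [|u c [v IH]].
  by exists 0; rewrite rmorph0 !horner0 expr0n mul0r addr0; case: q pq.
have [k Ek] : exists k : int, c ^+ q = c + k * q%:R.
  have /dvdzP[k Ek] : (q %| c ^+ q - c)%Z.
    have Er : (c %% q)%Z = `|(c %% q)%Z|%N :> int.
      by rewrite gez0_abs // modz_ge0 // eqz_nat -lt0n prime_gt0.
    rewrite -eqz_mod_dvd -modzXm Er -rmorphXn !modz_nat fermat_little //.
    by rewrite -modz_nat -Er modz_mod.
  by exists k; rewrite natz -Ek subrKC.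
have addX (a b : R) : exists w, (a + b) ^+ q = a ^+ q + b ^+ q + w * q%:R.
  exists (\sum_(i < q.+1 | (0 < i < q)%N) (a ^+ (q - i) * b ^+ i) *+ ('C(q, i) %/ q)).
  rewrite exprDn mulr_suml (bigID (fun i : 'I_q.+1 => (0 < i < q)%N)) /= addrC.
  congr (_ + _); last first.
    apply: eq_bigr => i /andP[i0 iq]; rewrite -[LHS]mulr_natr -[X in X * q%:R]mulr_natr.
    by rewrite -[RHS]mulrA -natrM divnK // prime_dvd_bin // i0.
  have q0 := prime_gt0 pq.
  rewrite (bigD1 ord0) ?ltnn //= subn0 expr0 mulr1 bin0 mulr1n; congr (_ + _).
  rewrite (bigD1 ord_max) /=; last by rewrite ltnn andbF -val_eqE /= -lt0n.
  rewrite subnn expr0 mul1r binn mulr1n big1 ?addr0 // => i.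
  rewrite -!val_eqE /= => /andP[/andP[ni0 i0] iq]; case/negP: ni0.
  by rewrite lt0n (negPf i0) /= ltn_neqAle (negPf iq) -ltnS ltn_ord.
rewrite rmorphD rmorphM /= map_polyX map_polyC /= !hornerMXaddC.
have [w' ->] := addX ((map_poly intr u).[z] * z) c%:~R.
exists (v * z ^+ q + k%:~R + w').
rewrite exprMn IH -rmorphXn Ek rmorphD rmorphM /= !natz /=; ring.
Qed.

(** * Prime ideals and their products *)

Section PrimeIdeals.

Variable R : comNzRingType.

(** Makes a reduction [phi] into a prime ideal, at which the condition on denominators in
    [reduces_to] can be tested. *)
Definition kernel_ideal (K : fieldType) (phi : {rmorphism R -> K}) : {pred R} :=
  fun x => phi x == 0.

Fact kernel_idealr_closed (K : fieldType) (phi : {rmorphism R -> K}) :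
  idealr_closed (kernel_ideal phi).
Proof.
split=> [||a x y]; rewrite !unfold_in ?rmorph0 ?rmorph1 ?oner_eq0 //.
by rewrite rmorphD rmorphM => /eqP-> /eqP->; rewrite mulr0 addr0.
Qed.

Fact kernel_prime_idealr_closed (K : fieldType) (phi : {rmorphism R -> K}) :
  prime_idealr_closed (kernel_ideal phi).
Proof. by move=> x y; rewrite !unfold_in rmorphM mulf_eq0. Qed.

HB.instance Definition _ (K : fieldType) (phi : {rmorphism R -> K}) :=
  isIdealr.Build R (kernel_ideal phi) (kernel_idealr_closed phi).
HB.instance Definition _ (K : fieldType) (phi : {rmorphism R -> K}) :=
  isPrimeIdealrClosed.Build R (kernel_ideal phi) (@kernel_prime_idealr_closed K phi).

(** Serves to transport denominators prime to [M] along Galois automorphisms. *)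
Definition comap_ideal (h : {rmorphism R -> R}) (P : prime_idealr R) : {pred R} :=
  fun x => h x \in (P : {pred R}).

Fact comap_idealr_closed (h : {rmorphism R -> R}) (P : prime_idealr R) :
  idealr_closed (comap_ideal h P).
Proof.
have inE x : (x \in comap_ideal h P) = (h x \in (P : {pred R})) by [].
split=> [||a x y]; rewrite !inE ?rmorph0 ?rmorph1 ?idealr0 ?idealr1 //.
by rewrite rmorphD rmorphM => hx hy; rewrite rpredD // idealMr.
Qed.

Fact comap_prime_idealr_closed (h : {rmorphism R -> R}) (P : prime_idealr R) :
  prime_idealr_closed (comap_ideal h P).
Proof.
have inE x : (x \in comap_ideal h P) = (h x \in (P : {pred R})) by [].
by move=> x y; rewrite !inE rmorphM prime_idealrM.
Qed.

HB.instance Definition _ (h : {rmorphism R -> R}) (P : prime_idealr R) :=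
  isIdealr.Build R (comap_ideal h P) (comap_idealr_closed h P).
HB.instance Definition _ (h : {rmorphism R -> R}) (P : prime_idealr R) :=
  isPrimeIdealrClosed.Build R (comap_ideal h P) (@comap_prime_idealr_closed h P).

Lemma prime_ideal_prod (P : prime_idealr R) (I : Type) (r : seq I) (F : I -> R) :
  \prod_(i <- r) F i \in (P : {pred R}) = has (fun i => F i \in (P : {pred R})) r.
Proof.
elim: r => [|i r IH] /=; first by rewrite big_nil idealr1.
by rewrite big_cons prime_idealrM IH.
Qed.

Lemma prime_idealX (P : prime_idealr R) (x : R) n :
  x ^+ n \in (P : {pred R}) -> x \in (P : {pred R}).
Proof.
elim: n => [|n IH]; first by rewrite expr0 idealr1.
by rewrite exprS prime_idealrM => /orP[].
Qed.

Section Products.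

Variables (k : nat) (P : 'I_k -> prime_idealr R).

Let prodI (r : seq 'I_k) :=
  \big[@ideal_mul R/@unit_ideal R]_(i <- r) (fun y => y \in (P i : {pred R})).

Lemma mem_ideal_prod (r : seq 'I_k) (x : R) i :
  i \in r -> prodI r x -> x \in (P i : {pred R}).
Proof.
rewrite /prodI; elim: r x => // j r IH x; rewrite inE big_cons => ij [s [hs ->]].
rewrite big_seq; apply: rpred_sum => u /hs[ha hb].
case/predU1P: ij => [->|ir]; first by rewrite mulrC idealMr.
by rewrite idealMr // IH.
Qed.

Lemma prod_in_ideal_prod (r : seq 'I_k) (x : 'I_k -> R) :
  (forall i, x i \in (P i : {pred R})) -> prodI r (\prod_(i <- r) x i).
Proof.
rewrite /prodI => hx; elim: r => [|j r IH]; first by rewrite !big_nil.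
rewrite !big_cons; exists [:: (x j, \prod_(i <- r) x i)].
split=> [u|]; last by rewrite big_seq1.
by rewrite inE => /eqP->; split=> //; apply: hx.
Qed.

(* If e carries one of the factors into M R, then each occurrence of that factor
   contributes a power of M. *)
Lemma ideal_prod_count (r : seq 'I_k) (D : pred 'I_k) (e m x : R) :
  (forall i y, D i -> y \in (P i : {pred R}) -> principal_ideal m (e * y)) ->
  prodI r x -> principal_ideal (m ^+ count D r) (e ^+ count D r * x).
Proof.
rewrite /prodI => hD; elim: r x => [|j r IH] x /=.
  by exists x; rewrite !expr0 !mul1r.
rewrite big_cons => -[s [hs ->]]; rewrite mulr_sumr.
have: forall u, u \in s -> principal_ideal (m ^+ (D j + count D r))
        (e ^+ (D j + count D r) * (u.1 * u.2)).
  move=> u /hs[h1 /IH[z Ez]]; case Dj: (D j) => /=.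
    have [y Ey] := hD _ _ Dj h1; exists (y * z).
    by rewrite !add1n !exprS mulrACA Ez Ey mulrACA.
  by exists (u.1 * z); rewrite add0n mulrCA Ez mulrCA.
elim: s {hs} => [|u s IHs] hs; first by exists 0; rewrite big_nil mulr0.
have [y Ey] := hs u (mem_head _ _).
have [|z Ez] := IHs; first by move=> v vs; apply: hs; rewrite inE vs orbT.
by exists (y + z); rewrite big_cons Ey Ez mulrDr.
Qed.

End Products.

End PrimeIdeals.

(** * Symmetric functions, products over cosets, roots of cyclotomic polynomials *)

Lemma prod_sub_esym (R : comNzRingType) (r : nat) (a : 'I_r -> R) (x : R) :
  \prod_(i < r) (x - a i) =
  \sum_(m < r.+1) (-1) ^+ m * x ^+ (r - m) *
     \sum_(I : {set 'I_r} | #|I| == m) \prod_(i in I) a i.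
Proof.
under eq_bigr => i _ do rewrite addrC.
rewrite bigA_distr (partition_big (fun I : {set 'I_r} => inord #|I| : 'I_r.+1) predT) //=.
apply: eq_bigr => m _; rewrite mulr_sumr; apply: eq_big => [I|I /eqP Em].
  rewrite -val_eqE /= inordK // ltnS.
  by rewrite -[X in (_ <= X)%N](card_ord r) max_card.
have {}Em: #|I| = m.
  by rewrite -Em inordK // ltnS -[X in (_ <= X)%N](card_ord r) max_card.
rewrite (bigID (mem I)) /=.
rewrite (eq_bigr (fun i => -1 * a i)) => [|i iI]; last by rewrite iI mulN1r.
rewrite big_split /= prodr_const Em mulrAC; congr (_ * _ * _).
rewrite (eq_bigr (fun=> x)) => [|i /negPf->] //.
have <- : #|~: I| = (r - m)%N by rewrite cardsCs setCK card_ord Em.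
by rewrite -prodr_const; apply: eq_bigl => i; rewrite inE.
Qed.

Lemma prod_transversal (gT : finGroupType) (R : comNzRingType) (H G : {group gT})
    (X : {set gT}) (w : gT -> R) :
  H \subset G -> is_transversal X (rcosets H G) G ->
  \prod_(g in G) w g = \prod_(x in X) \prod_(h in H) w (h * x)%g.
Proof.
move=> sHG trX; have /and3P[pG sXG _] := trX.
rewrite (set_partition_big _ (rcosets_partition sHG)) /=.
have XP x : x \in X -> pblock (rcosets H G) x = (H :* x)%g.
  move=> xX; apply: def_pblock; first by case/and3P: pG.
    by apply/rcosetsP; exists x => //; apply: (subsetP sXG).
  exact: rcoset_refl.
rewrite -(pblock_transversal trX) /= big_imset /=; last exact: (pblock_inj trX).
apply: eq_bigr => x xX; rewrite XP // -rcosetE /rcoset.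
by rewrite big_imset //= => g h _ _; apply: mulIg.
Qed.

(** Holds in every characteristic: [z ^+ n = 1] makes some ['Phi_d] with [d] dividing [n] vanish at
    [z]; then [z ^+ d = 1], which forces [d = n]. *)
Lemma root_Cyclotomic (F : fieldType) (n : nat) (z : F) :
  n.-primitive_root z -> (map_poly intr 'Phi_n).[z] = 0.
Proof.
move=> pz; have n0 := prim_order_gt0 pz.
have rootXn (d : nat) : (0 < d)%N ->
    (map_poly intr (\prod_(k <- divisors d) 'Phi_k)).[z] = z ^+ d - 1.
  by move=> d0; rewrite prod_Cyclotomic // rmorphB rmorph1 /= map_polyXn !hornerE.
have := rootXn _ n0; rewrite (prim_expr_order pz) subrr rmorph_prod horner_prod.
move/eqP; rewrite prodf_seq_eq0 => /hasP[d]; rewrite -dvdn_divisors // => ddvn /eqP d_0.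
suff /eqP <- : d == n by [].
have d0 : (0 < d)%N by apply: dvdn_gt0 ddvn.
rewrite eqn_dvd ddvn /= (prim_order_dvd pz) -subr_eq0 -rootXn //.
by rewrite (big_rem d) /= ?divisors_id // rmorphM hornerM d_0 mul0r.
Qed.

(** * The field [L], its Galois group and the ring O *)

Section CyclotomicRing.

Variables (L : splittingFieldType rat) (zeta : L) (p : nat).
Hypotheses (hp : prime p) (hzeta : p.-primitive_root zeta).
Hypothesis hL : <<1; zeta>>%VS = fullv.

Local Notation galT := (gal_of {:L}).
Local Notation O := (Zring zeta).

(** Irreducibility of ['Phi_p], borrowed from [algC]: the gcd of ['Phi_p] and [v] vanishes at
    [zeta], so it is not constant and has a complex root; this is a primitive [p]-th root of unity,
    with minimal polynomial ['Phi_p]. *)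
Lemma Cyclotomic_dvd_rat (v : {poly rat}) :
  (map_poly (in_alg L) v).[zeta] = 0 -> map_poly intr 'Phi_p %| v.
Proof.
move=> v0; set P := map_poly intr 'Phi_p : {poly rat}.
have P0 : (map_poly (in_alg L) P).[zeta] = 0.
  rewrite -map_poly_comp -[RHS](root_Cyclotomic hzeta); congr _.[_].
  by apply: eq_map_poly => x; exact: rmorph_int.
have gr : root (map_poly (in_alg L) (gcdp P v)) zeta.
  by rewrite gcdp_map root_gcd /root P0 v0 eqxx.
have : size (map_poly ratr (gcdp P v) : {poly algC}) != 1%N.
  rewrite size_map_poly; apply/negP => /size_poly1P[c c0 Ec].
  by move: gr; rewrite Ec map_polyC rootC /= scaler_eq0 oner_eq0 orbF (negPf c0).
case/closed_rootP => z gz.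
have pz : p.-primitive_root z.
  have [z1 pz1] := C_prim_root_exists (prime_gt0 hp).
  rewrite -(root_cyclotomic pz1) -(Cintr_Cyclotomic pz1).
  move: gz; rewrite gcdp_map root_gcd => /andP[+ _]; congr root.
  by rewrite -map_poly_comp; apply: eq_map_poly => x /=; rewrite rmorph_int.
have [q [Eq _] /(_ (gcdp P v))] := minCpolyP z; rewrite gz => /esym dvq.
suff -> : P = q by apply: dvdp_trans dvq (dvdp_gcdr _ _).
apply: (map_poly_inj (ratr : {rmorphism rat -> algC})).
rewrite -Eq (minCpoly_cyclotomic pz) -(Cintr_Cyclotomic pz) -map_poly_comp.
by apply: eq_map_poly => x; exact: rmorph_int.
Qed.

(** Gauss's lemma: the quotient is integral since ['Phi_p] is monic, hence primitive. *)
Lemma Cyclotomic_dvd_int (u : {poly int}) :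
  (map_poly intr u).[zeta] = 0 -> exists v, u = 'Phi_p * v.
Proof.
move=> u0; have : map_poly intr 'Phi_p %| (map_poly intr u : {poly rat}).
  apply: Cyclotomic_dvd_rat; rewrite -map_poly_comp -[RHS]u0; congr _.[_].
  by apply: eq_map_poly => x; exact: rmorph_int.
rewrite dvdp_rat_int => /dvdpP_int[v ->]; exists v.
by rewrite zprimitive_monic // Cyclotomic_monic.
Qed.

Lemma gal_mem (s : galT) : s \in 'Gal({:L} / 1)%g.
Proof. by rewrite gal_kHom ?subvf // k1AHom. Qed.

Lemma gal_zeta_inj (s t : galT) : s zeta = t zeta -> s = t.
Proof.
move=> st; apply/eqP/gal_eqP => x _.
have /Fadjoin_polyP[q /polyOver1P[r ->] ->] : x \in <<1; zeta>>%VS by rewrite hL memvf.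
have fixr (g : galT) : map_poly g (map_poly (in_alg L) r) = map_poly (in_alg L) r.
  apply: (@fixedPoly_gal _ _ 1%AS {:L}%AS); [exact: sub1v|exact: gal_mem|].
  by apply/polyOver1P; exists r.
by rewrite -!horner_map !fixr /= st.
Qed.

Fact gal_zeta_expr (s : galT) : (s zeta) ^+ p = 1.
Proof. by rewrite -rmorphXn (prim_expr_order hzeta) rmorph1. Qed.

(** The cyclotomic character, with natural number values so that it can serve as an exponent; it is
    multiplicative only modulo [p]. *)
Definition chi (s : galT) : nat := sval (prim_rootP hzeta (gal_zeta_expr s)).

Lemma chiE (s : galT) : s zeta = zeta ^+ chi s.
Proof. by rewrite /chi; case: prim_rootP. Qed.

Lemma chi_coprime (s : galT) : coprime (chi s) p.
Proof.
rewrite -(prim_root_exp_coprime _ hzeta) -chiE.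
by rewrite fmorph_primitive_root.
Qed.

Lemma chiM (s t : galT) : chi (s * t)%g = (chi s * chi t)%N %[mod p].
Proof.
apply/eqP; rewrite -(eq_prim_root_expr hzeta) -chiE galM ?memvf // chiE rmorphXn.
by rewrite /= chiE -exprM mulnC.
Qed.

Lemma chi1 : chi 1%g = 1%N %[mod p].
Proof. by apply/eqP; rewrite -(eq_prim_root_expr hzeta) -chiE gal_id. Qed.

Lemma chi_inj (s t : galT) : chi s = chi t %[mod p] -> s = t.
Proof.
by move/eqP; rewrite -(eq_prim_root_expr hzeta) -!chiE => /eqP; apply: gal_zeta_inj.
Qed.

Lemma gal_commute (s t : galT) : commute s t.
Proof. by apply: chi_inj; rewrite !chiM mulnC. Qed.

(** The default value in [sigma] is not reached: ['Phi_p] divides the minimal polynomial of [zeta],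
    so [zeta ^ c] is a root of it, and normality provides the automorphism. *)
Lemma sigmaE (c : int) : coprimez c p%:Z -> sigma zeta c zeta = zeta ^ c.
Proof.
move=> cp; rewrite /sigma; case: pickP => /= [s /eqP //|/(_ _)/negP no].
have z0 : zeta != 0.
  apply/eqP => z0; have /eqP := prim_expr_order hzeta.
  by rewrite z0 expr0n eqn0Ngt prime_gt0 // eq_sym oner_eq0.
have p0 : (p%:Z != 0)%R by rewrite eqz_nat -lt0n prime_gt0.
have [m Em cm] : exists2 m : nat, zeta ^ c = zeta ^+ m & coprime m p.
  have zp : zeta ^ p%:Z = 1 by rewrite -exprnP prim_expr_order.
  exists `|(c %% p)%Z|%N.
    rewrite exprnP gez0_abs ?modz_ge0 // {1}(divz_eq c p) expfzDr //.
    by rewrite [(c %/ p)%Z * _]mulrC -exprz_exp zp exp1rz mul1r.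
  by move: cp; rewrite /coprimez -gcdz_modl -/(coprimez _ _) coprimezE.
have pc : p.-primitive_root (zeta ^ c).
  by rewrite Em (prim_root_exp_coprime _ hzeta).
have rc : root (minPoly 1%AS zeta) (zeta ^ c).
  have /polyOver1P[r Er] := minPolyOver 1%AS zeta.
  have /dvdpP[v Ev] : map_poly intr 'Phi_p %| r.
    by apply: Cyclotomic_dvd_rat; rewrite -Er; apply/eqP; exact: root_minPoly.
  rewrite Er Ev rmorphM /= /root hornerM mulf_eq0 -map_poly_comp; apply/orP; right.
  apply/eqP; rewrite -[RHS](root_Cyclotomic pc); congr _.[_].
  by apply: eq_map_poly => x; exact: rmorph_int.
have [s _ Es] := normalField_root_minPoly (sub1v _) (normalFieldf 1%AS) (memvf zeta) rc.
by case: (no s); rewrite Es.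
Qed.

Lemma sigmaP (s : galT) (c : int) : coprimez c p%:Z -> s zeta = zeta ^ c -> s = sigma zeta c.
Proof. by move=> cp Es; apply: gal_zeta_inj; rewrite sigmaE. Qed.

Fact zeta_Zadjoin : zeta \in Zadjoin zeta.
Proof. by apply/asboolP; exists 'X; rewrite map_polyX hornerX. Qed.

Definition zetaZ : O := exist _ zeta zeta_Zadjoin.

Lemma val_hornerZ (u : {poly int}) (x : O) :
  val (map_poly intr u).[x] = (map_poly intr u).[val x].
Proof.
rewrite -(horner_map (val : {rmorphism O -> L})) -map_poly_comp; congr _.[_].
by apply: eq_map_poly => k; exact: rmorph_int.
Qed.

Lemma Zring_horner (x : O) : exists u : {poly int}, x = (map_poly intr u).[zetaZ].
Proof.
have /asboolP[u Eu] := svalP x; exists u; apply: val_inj.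
by rewrite val_hornerZ.
Qed.

Lemma rmorph_Zring (R : nzRingType) (phi : {rmorphism O -> R}) (u : {poly int}) (x : O) :
  phi (map_poly intr u).[x] = (map_poly intr u).[phi x].
Proof.
rewrite -(horner_map phi) -map_poly_comp; congr _.[_].
by apply: eq_map_poly => k; exact: rmorph_int.
Qed.

Fact gal_Zadjoin (s : galT) (x : O) : s (val x) \in Zadjoin zeta.
Proof.
have [u ->] := Zring_horner x; rewrite val_hornerZ -(horner_map s) -map_poly_comp /=.
rewrite (@eq_map_poly _ _ (s \o intr) intr) => [|k]; last exact: rmorph_int.
apply/asboolP; exists (u \Po 'X^(chi s)).
by rewrite map_comp_poly horner_comp map_polyXn hornerXn chiE.
Qed.

Definition galZ (s : galT) (x : O) : O := exist _ (s (val x)) (gal_Zadjoin s x).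

Fact galZ_is_zmod_morphism s : zmod_morphism (galZ s).
Proof. by move=> x y; apply: val_inj; rewrite /= !rmorphB. Qed.

Fact galZ_is_monoid_morphism s : monoid_morphism (galZ s).
Proof. by split=> [|x y]; apply: val_inj; rewrite /= ?rmorph1 ?rmorphM. Qed.

HB.instance Definition _ s := GRing.isZmodMorphism.Build O O (galZ s) (galZ_is_zmod_morphism s).
HB.instance Definition _ s := GRing.isMonoidMorphism.Build O O (galZ s) (galZ_is_monoid_morphism s).

Lemma galZ_zeta s : galZ s zetaZ = zetaZ ^+ chi s.
Proof. by apply: val_inj; rewrite (rmorphXn (val : {rmorphism O -> L})) /= chiE. Qed.

Lemma galZM s t x : galZ (s * t)%g x = galZ t (galZ s x).
Proof. by apply: val_inj; rewrite /= galM ?memvf. Qed.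

Lemma galZ1 x : galZ 1%g x = x.
Proof. by apply: val_inj; rewrite /= gal_id. Qed.

End CyclotomicRing.

(** * The automorphisms [sigma c] and the order of [M] modulo [p] *)

Lemma exprz_mod (F : fieldType) (p : nat) (x : F) (a b : int) :
  (0 < p)%N -> x ^+ p = 1 -> (a = b %[mod p])%Z -> x ^ a = x ^ b.
Proof.
move=> p0 xp /eqP; rewrite eqz_mod_dvd => /dvdzP[k /eqP].
rewrite subr_eq addrC => /eqP->; have x0 : x != 0.
  by apply: contra_eq_neq xp => ->; rewrite expr0n eqn0Ngt p0 eq_sym oner_eq0.
by rewrite expfzDr // [k * _]mulrC -exprz_exp -exprnP xp exp1rz mulr1.
Qed.

Section Sigma.
Variables (L : splittingFieldType rat) (zeta : L) (p : nat).
Hypotheses (hp : prime p) (hzeta : p.-primitive_root zeta).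
Hypothesis hL : <<1; zeta>>%VS = fullv.

Local Notation sigma := (sigma zeta).
Local Notation chi := (chi hzeta).
Local Notation sigmaE := (sigmaE hp hzeta).
Local Notation sigmaP := (sigmaP hp hzeta hL).

Lemma zeta_neq0 : zeta != 0.
Proof.
apply/eqP => z0; have /eqP := prim_expr_order hzeta.
by rewrite z0 expr0n eqn0Ngt prime_gt0 // eq_sym oner_eq0.
Qed.

Lemma zetaz_mod (a b : int) : (a = b %[mod p])%Z -> zeta ^ a = zeta ^ b.
Proof. exact: (exprz_mod (prime_gt0 hp) (prim_expr_order hzeta)). Qed.

Lemma sigma_mod (a b : int) : coprimez a p -> (a = b %[mod p])%Z -> sigma a = sigma b.
Proof.
move=> cap ab; have cbp : coprimez b p.
  by rewrite /coprimez -gcdz_modl -ab gcdz_modl.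
by apply: sigmaP => //; rewrite sigmaE //; apply: zetaz_mod.
Qed.

Lemma sigmaM (a b : int) :
  coprimez a p -> coprimez b p -> sigma (a * b) = (sigma a * sigma b)%g.
Proof.
move=> ca cb; apply/esym/sigmaP => //; first by rewrite coprimezMl ca.
by rewrite galM ?memvf // (sigmaE ca) fmorphXz /= (sigmaE cb) exprz_exp mulrC.
Qed.

Lemma sigma1 : sigma 1 = 1%g.
Proof.
by apply/esym/sigmaP; [rewrite coprimezE coprime1n | rewrite gal_id expr1z].
Qed.

Lemma sigmaX (a : int) j : coprimez a p -> sigma (a ^+ j) = (sigma a ^+ j)%g.
Proof.
move=> ca; elim: j => [|j IH]; first by rewrite expr0 expg0 sigma1.
by rewrite exprS expgS sigmaM ?IH // coprimezXl.
Qed.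

Lemma coprimezN1 : coprimez (-1) p.
Proof. by rewrite coprimezE abszN coprime1n. Qed.

Lemma sigmaN (a : int) : coprimez a p -> sigma (- a) = (sigma a * sigma (-1))%g.
Proof. by move=> ca; rewrite -sigmaM ?coprimezN1 // mulrN1. Qed.

Lemma sigmaN1K : (sigma (-1) * sigma (-1))%g = 1%g.
Proof. by rewrite -sigmaM ?coprimezN1 // mulrNN mulr1 sigma1. Qed.

Lemma sigmaN1V : (sigma (-1))^-1%g = sigma (-1).
Proof. by apply: (mulgI (sigma (-1))); rewrite mulgV sigmaN1K. Qed.

Lemma chi_sigma (a : int) : coprimez a p -> (chi (sigma a) = a %[mod p])%Z.
Proof.
move=> ca; have : zeta ^ (chi (sigma a))%:Z = zeta ^ a by rewrite -exprnP -chiE sigmaE.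
have [m Em] : exists m : nat, (a = m %[mod p])%Z.
  exists `|(a %% p)%Z|%N; rewrite gez0_abs ?modz_mod // modz_ge0 //.
  by rewrite eqz_nat -lt0n prime_gt0.
rewrite Em (zetaz_mod Em) -!exprnP => /eqP; rewrite (eq_prim_root_expr hzeta) => /eqP E.
by rewrite !modz_nat E.
Qed.

Lemma Fp_natr_eq (a b : nat) : (a%:R == b%:R :> 'F_p) = (a == b %[mod p])%N.
Proof.
by rewrite -val_eqE /= !val_Fp_nat.
Qed.

Section Order.

Variables (M f : nat).
Hypothesis hf : f.-primitive_root (M%:R : 'F_p).

Lemma order_eq_mod i j : (M ^ i == M ^ j %[mod p])%N = (i == j %[mod f])%N.
Proof. by rewrite -Fp_natr_eq !natrX (eq_prim_root_expr hf). Qed.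

Lemma order_coprime : coprime M p.
Proof.
rewrite coprime_sym prime_coprime //; apply/negP => /dvdnP[k EM].
have := prim_expr_order hf; rewrite EM natrM pchar_Fp_0 // mulr0 expr0n.
by rewrite eqn0Ngt (prim_order_gt0 hf) => /esym/eqP; rewrite oner_eq0.
Qed.

Lemma order_coprimez : coprimez M p.
Proof. by rewrite coprimezE order_coprime. Qed.

Lemma order_dvd : (f %| p.-1)%N.
Proof.
rewrite (prim_order_dvd hf) -natrX -(Fp_nat_mod hp) -totient_prime //.
by rewrite Euler_exp_totient ?order_coprime // Fp_nat_mod.
Qed.

End Order.

End Sigma.

(** * The exponent of [tau] is killed by [1 + sigma_{-1}] *)

Section TauExponent.
Variables (L : splittingFieldType rat) (zeta : L) (p : nat).
Hypotheses (hp : prime p) (hzeta : p.-primitive_root zeta).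
Hypothesis hL : <<1; zeta>>%VS = fullv.

Local Notation galT := (gal_of {:L}).
Local Notation sigma := (sigma zeta).
Local Notation gal_commute := (gal_commute hzeta hL).

Variables (M f : nat).
Hypothesis hf : f.-primitive_root (M%:R : 'F_p).

Let order_coprimez := order_coprimez hp hf.
Local Notation sigmaX := (sigmaX hp hzeta hL).
Local Notation sigmaM := (sigmaM hp hzeta hL).
Local Notation coprimezN1 := (coprimezN1 p).

Lemma sigma_order : (sigma M%:Z ^+ f)%g = 1%g.
Proof.
rewrite -sigmaX // -(sigma1 hp hzeta hL); apply: (sigma_mod hp hzeta hL).
  by rewrite coprimezXl.
rewrite -rmorphXn !modz_nat; congr Posz; apply/eqP.
by rewrite (order_eq_mod hp hf f 0) modnn mod0n.
Qed.

(** [M ^ (f/2)] is a square root of 1 modulo the prime [p], and it is not 1 since [f/2 < f]; hence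
    it is -1. *)
Lemma sigma_half : ~~ odd f -> (sigma M%:Z ^+ f./2)%g = sigma (-1).
Proof.
move=> f_even; rewrite -sigmaX //; apply: (sigma_mod hp hzeta hL).
  by rewrite coprimezXl.
have f0 := prim_order_gt0 hf; have f2 : (f./2 < f)%N by lia.
have : (M ^ f./2 * M ^ f./2 == 1 %[mod p])%N.
  by rewrite -expnD addnn halfK (negPf f_even) subn0 (order_eq_mod hp hf f 0) modnn mod0n.
rewrite -rmorphXn; set a := (M ^ f./2)%N => aa.
have : (p%:Z %| (a%:Z - 1) * (a%:Z + 1))%Z.
  rewrite (_ : _ * _ = (a * a)%N%:Z - 1%N%:Z); last by rewrite PoszM; ring.
  by rewrite -eqz_mod_dvd !modz_nat.
rewrite Gauss_dvdzr; first by rewrite -[1]opprK -eqz_mod_dvd => /eqP.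
rewrite coprimezE prime_coprime //; apply/negP => pa.
suff : (a == 1 %[mod p])%N.
  rewrite (order_eq_mod hp hf _ 0) mod0n modn_small // => /eqP f20.
  by have := half_gt0 f; rewrite f20 ltnn; case: (f) f_even f0 => [|[]].
by rewrite -eqz_nat -!modz_nat eqz_mod_dvd.
Qed.

Local Notation e_ := (@igring_elt galT).
Local Notation D := (\prod_(d <- divisors f | (d < f)%N) (map_poly intr 'Phi_d).[e_ (sigma M%:Z)]).

Fact igring_intr_commr (x : int_group_ring galT) : commr_rmorph intr x.
Proof. by move=> k; apply: commr_int. Qed.

Lemma igring_eltX (g : galT) j : e_ g ^+ j = e_ (g ^+ j)%g.
Proof.
elim: j => [|j IH]; first by rewrite expr0 expg0.
by rewrite exprS IH igring_eltM expgS.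
Qed.

(** Every divisor of [f/2] is a proper divisor of [f], so the product contains [X^(f/2) - 1], while
    [1 + sigma_{-1}] is [X^(f/2) + 1] at [sigma_M]; together they give a multiple of [X^f - 1],
    which vanishes there. *)
Lemma Cyclotomic_elt_bar : ~~ odd f -> D * (1 + e_ (sigma (-1))) = 0.
Proof.
move=> f_even; set e := e_ (sigma M%:Z).
have f0 := prim_order_gt0 hf.
have h0 : (0 < f./2)%N by rewrite half_gt0; case: (f) f_even f0 => [|[]].
have ff : f = (f./2).*2 by rewrite halfK (negPf f_even) subn0.
(* Evaluation at [sigma_M] as a ring morphism moves the identity to integer polynomials. *)
pose ev := horner_morph (igring_intr_commr e).
have evE u : ev u = (map_poly intr u).[e] by [].
under eq_bigr => d _ do rewrite -evE.
rewrite -rmorph_prod.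
have -> : 1 + e_ (sigma (-1)) = ev ('X^(f./2) + 1).
  rewrite evE rmorphD rmorph1 /= map_polyXn hornerD hornerXn hornerC addrC.
  by rewrite igring_eltX sigma_half.
rewrite -rmorphM.
have [q Eq] : exists q, \prod_(d <- divisors f | (d < f)%N) 'Phi_d = q * ('X^(f./2) - 1).
  rewrite -prod_Cyclotomic // -big_filter.
  have sub : {subset divisors f./2 <= [seq d <- divisors f | (d < f)%N]}.
    move=> d; rewrite mem_filter -!dvdn_divisors // => dh; apply/andP; split.
      by apply: leq_ltn_trans (dvdn_leq h0 dh) _; lia.
    by apply: dvdn_trans dh _; rewrite {2}ff -muln2 dvdn_mulr.
  exists (\prod_(d <- divisors f | (d < f)%N && (d \notin divisors f./2)) 'Phi_d).
  rewrite (bigID (mem (divisors f./2))) /= mulrC; congr (_ * _).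
    by rewrite big_filter_cond.
  rewrite -[LHS]big_filter; apply: perm_big.
  apply: uniq_perm; rewrite ?filter_uniq ?divisors_uniq // => d.
  by rewrite mem_filter; apply/andP/idP=> [[]//|dh]; split=> //; exact: sub.
rewrite Eq -mulrA -subr_sqr expr1n -exprM muln2 -ff.
rewrite rmorphM [X in _ * X]evE rmorphB rmorph1 /= map_polyXn hornerD hornerN hornerXn hornerC igring_eltX.
by rewrite sigma_order subrr mulr0.
Qed.

(** Each summand is a multiple of [1 - sigma_{-1}], and [sigma_{-1}] is an involution. *)
Lemma gamma_bar (S : seq int) : odd f -> all (fun i => coprimez i p) S ->
  gamma zeta f S * (1 + e_ (sigma (-1))) = 0.
Proof.
move=> f_odd cS; rewrite /gamma f_odd mulr_suml big_seq big1 // => i /(allP cS) ci.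
rewrite mulrzAl mulrDr mulr1 mulrBl !igring_eltM !(sigmaN hp hzeta hL ci) !invMg.
rewrite (sigmaN1V hp hzeta hL) (gal_commute (sigma (-1))) -mulgA (sigmaN1K hp hzeta hL).
by rewrite mulg1 -[X in X + _]opprB addNr mul0rz.
Qed.

(** The factor that is killed is [gamma] for odd [f] and the cyclotomic product for even [f]. This
    is what makes [tau] times its conjugate equal to 1. *)
Lemma tau_exponent_bar (n : nat) (S : seq int) :
  all (fun i => coprimez i p) S ->
  tau_exponent zeta p n M f S * (1 + e_ (sigma (-1))) = 0.
Proof.
move=> cS; rewrite /tau_exponent mulrzAl; case: (boolP (odd f)) => fo.
  rewrite -mulrA (igring_mulC _ (1 + _)); last exact: gal_commute.
  by rewrite mulrA gamma_bar // mul0r mul0rz.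
by rewrite -mulrA Cyclotomic_elt_bar // mulr0 mul0rz.
Qed.

End TauExponent.

(** * Reductions of O to fields of prime characteristic *)

Section Reduction.
Variables (L : splittingFieldType rat) (zeta : L) (p : nat).
Hypotheses (hp : prime p) (hzeta : p.-primitive_root zeta).
Hypothesis hL : <<1; zeta>>%VS = fullv.

Local Notation galT := (gal_of {:L}).
Local Notation O := (Zring zeta).
Local Notation sigma := (sigma zeta).
Local Notation galZ := (galZ hzeta).
Local Notation zetaZ := (zetaZ zeta).

(** Send [zeta] to a root of ['Phi_p] in an algebraic closure of ['F_q]; the value does not depend
    on the chosen polynomial in [zeta], because two choices differ by a multiple of ['Phi_p]. *)
Lemma reduction_exists (q : nat) : prime q ->
  exists (K : fieldType) (phi : {rmorphism O -> K}), q%:R = 0 :> K.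
Proof.
move=> pq; have [K [FK _]] := countable_algebraic_closure 'F_q.
have [z0 rz0] : exists z0 : K, root (map_poly intr 'Phi_p) z0.
  apply/closed_rootP; rewrite size_map_poly_id0.
    by rewrite size_Cyclotomic totient_prime //; have := prime_gt1 hp; case: (p) => [|[]].
  by rewrite (monicP (Cyclotomic_monic p)) rmorph1 oner_eq0.
pose rep (x : O) := sval (cid (Zring_horner x)).
have repE x : x = (map_poly intr (rep x)).[zetaZ] by rewrite /rep; case: cid.
pose phi (x : O) : K := (map_poly intr (rep x)).[z0].
have phiE (x : O) u : x = (map_poly intr u).[zetaZ] -> phi x = (map_poly intr u).[z0].
  move=> Eu; apply/eqP; rewrite /phi -subr_eq0 -hornerN -hornerD -rmorphB.
  have [v ->] : exists v, rep x - u = 'Phi_p * v.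
    apply: (Cyclotomic_dvd_int hp hzeta).
    rewrite -[zeta]/(val zetaZ) -val_hornerZ rmorphB hornerD hornerN.
    by rewrite -repE -Eu subrr rmorph0.
  by rewrite rmorphM hornerM (eqP rz0) mul0r.
have phiB : zmod_morphism phi.
  move=> x y; rewrite (phiE _ (rep x - rep y)) ?rmorphB ?hornerD ?hornerN //.
  by rewrite -!repE.
have phiM : monoid_morphism phi.
  split=> [|x y]; first by rewrite (phiE _ 1) ?rmorph1 ?hornerC.
  rewrite (phiE _ (rep x * rep y)) ?rmorphM ?hornerM //.
  by rewrite -!repE.
pose aM := GRing.isZmodMorphism.Build O K phi phiB.
pose mM := GRing.isMonoidMorphism.Build O K phi phiM.
pose phiR : {rmorphism O -> K} := HB.pack phi aM mM.
exists K, phiR; rewrite -(rmorph_nat FK).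
by rewrite pchar_Fp_0 // rmorph0.
Qed.

Lemma val_ZringD (x y : O) : val (x + y) = val x + val y. Proof. by []. Qed.

Lemma val_ZringM (x y : O) : val (x * y) = val x * val y. Proof. by []. Qed.

Lemma Zring_mul_eq0 (x y : O) : x * y = 0 -> x = 0 \/ y = 0.
Proof.
move/(congr1 val); rewrite (rmorphM (val : {rmorphism O -> L})) => /eqP.
by rewrite mulf_eq0 => /orP[] /eqP E; [left | right]; apply: val_inj.
Qed.

Section Phi.

Variables (K : fieldType) (phi : {rmorphism O -> K}).

(** In O the sum of the powers [zeta ^ (i j)], [j < p], is 0 because [zeta ^ i] is not 1; if [phi]
    sent [zeta ^ i] to 1, that sum would reduce to [p]. *)
Lemma reduction_zetaX i : (i%%p)%N != 0%N -> p%:R != 0 :> K -> phi zetaZ ^+ i != 1.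
Proof.
move=> ip pK; apply/eqP => z1.
have zi1 : zetaZ ^+ i != 1.
  rewrite -(inj_eq val_inj) (rmorphXn (val : {rmorphism O -> L})) /=.
  by rewrite -(expr0 zeta) (eq_prim_root_expr hzeta) mod0n.
have : (zetaZ ^+ i - 1) * \sum_(j < p) (zetaZ ^+ i) ^+ j = 0.
  rewrite -subrX1 -exprM mulnC exprM.
  apply: val_inj; rewrite rmorphB rmorph1 !(rmorphXn (val : {rmorphism O -> L})) /=.
  by rewrite (prim_expr_order hzeta) expr1n subrr.
case/Zring_mul_eq0 => [/eqP|]; first by rewrite subr_eq0 (negPf zi1).
move/(congr1 phi); rewrite rmorph_sum rmorph0 => /eqP.
rewrite (eq_bigr (fun=> 1)) => [|j _]; last by rewrite !rmorphXn /= z1 expr1n.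
by rewrite sumr_const card_ord (negPf pK).
Qed.

Lemma reduction_prim : p%:R != 0 :> K -> p.-primitive_root (phi zetaZ).
Proof.
move=> pK; have zp : phi zetaZ ^+ p = 1.
  rewrite -rmorphXn (_ : zetaZ ^+ p = 1) ?rmorph1 //; apply: val_inj.
  by rewrite (rmorphXn (val : {rmorphism O -> L})) /= (prim_expr_order hzeta).
have [m pm] := prim_order_exists (prime_gt0 hp) zp.
case/primeP: hp => p1 pdvd /[dup] mp /pdvd /orP[/eqP m1|/eqP <- //].
have : (1 %% p)%N != 0%N by rewrite modn_small // prime_gt1.
move/reduction_zetaX => /(_ pK); rewrite expr1.
by have := prim_expr_order pm; rewrite m1 expr1 => ->; rewrite eqxx.
Qed.

Lemma reduction_frobenius (q : nat) (u : {poly int}) (z : K) j : prime q -> q%:R = 0 :> K ->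
  (map_poly intr u).[z] ^+ (q ^ j) = (map_poly intr u).[z ^+ (q ^ j)].
Proof.
move=> pq qK; elim: j => [|j IH]; first by rewrite expn0 !expr1.
rewrite expnSr exprM IH; have [v ->] := horner_intr_exp u (z ^+ (q ^ j)) pq.
by rewrite qK mulr0 addr0 -exprM.
Qed.

Lemma reduction_frobenius_id (q : nat) (x : O) j : prime q -> q%:R = 0 :> K ->
  (q ^ j = 1 %[mod p])%N -> phi x ^+ (q ^ j) = phi x.
Proof.
move=> pq qK qj; have [u ->] := Zring_horner x.
rewrite rmorph_Zring reduction_frobenius //; congr _.[_].
have zp : zetaZ ^+ p = 1.
  by apply: val_inj; rewrite (rmorphXn (val : {rmorphism O -> L})) /= (prim_expr_order hzeta).
rewrite -rmorphXn (divn_eq (q ^ j) p) mulnC exprD exprM zp expr1n mul1r qj.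
by rewrite modn_small ?prime_gt1.
Qed.

(** The graph of the extension of [phi] to the local ring at its kernel; [loc_value_inj] shows it to
    be single-valued. *)
Definition loc_value (x : L) (a : K) : Prop :=
  exists y d : O, [/\ phi d != 0, x * val d = val y & a * phi d = phi y].

Lemma val_neq0 (d : O) : phi d != 0 -> val d != 0.
Proof.
by apply: contra_neq => d0; rewrite (_ : d = 0) ?rmorph0 //; apply: val_inj.
Qed.

Lemma loc_value_inj x a b : loc_value x a -> loc_value x b -> a = b.
Proof.
move=> [y [d [d0 xy ay]]] [y' [d' [d'0 xy' ay']]].
have E : y * d' = y' * d.
  by apply: val_inj; rewrite !val_ZringM -xy -xy' mulrAC.
apply: (mulIf d0); apply: (mulIf d'0).
by rewrite ay [RHS]mulrAC ay' -!rmorphM E.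
Qed.

Lemma loc_value_val (y : O) : loc_value (val y) (phi y).
Proof. by exists y, 1; rewrite !rmorph1 !mulr1 oner_eq0. Qed.

Lemma loc_valueD x x' a a' :
  loc_value x a -> loc_value x' a' -> loc_value (x + x') (a + a').
Proof.
move=> [y [d [d0 xy ay]]] [y' [d' [d'0 xy' ay']]].
exists (y * d' + y' * d), (d * d'); split; first by rewrite rmorphM mulf_neq0.
  by rewrite val_ZringD !val_ZringM -xy -xy'; ring.
by rewrite rmorphD !(rmorphM phi) -ay -ay'; ring.
Qed.

Lemma loc_valueM x x' a a' :
  loc_value x a -> loc_value x' a' -> loc_value (x * x') (a * a').
Proof.
move=> [y [d [d0 xy ay]]] [y' [d' [d'0 xy' ay']]].
exists (y * y'), (d * d'); split; first by rewrite rmorphM mulf_neq0.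
  by rewrite !val_ZringM -xy -xy'; ring.
by rewrite !(rmorphM phi) -ay -ay'; ring.
Qed.

Lemma loc_valueV x a : a != 0 -> loc_value x a -> loc_value x^-1 a^-1.
Proof.
move=> a0 [y [d [d0 xy ay]]]; have y0 : phi y != 0 by rewrite -ay mulf_neq0.
have x0 : x != 0 by apply: contraNneq (val_neq0 y0) => x0; rewrite -xy x0 mul0r.
by exists d, y; split=> //; rewrite -?ay -?xy mulKf.
Qed.

Lemma loc_value_sum (I : Type) (r : seq I) (P : pred I) (F : I -> L) (A : I -> K) :
  (forall i, P i -> loc_value (F i) (A i)) ->
  loc_value (\sum_(i <- r | P i) F i) (\sum_(i <- r | P i) A i).
Proof.
move=> FA; elim/big_rec2: _ => [|i a x Pi]; last by apply: loc_valueD; apply: FA.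
by have := loc_value_val 0; rewrite !rmorph0.
Qed.

Lemma loc_value1 : loc_value 1 1.
Proof. by have := loc_value_val 1; rewrite !rmorph1. Qed.

Lemma loc_value_prod (I : Type) (r : seq I) (P : pred I) (F : I -> L) (A : I -> K) :
  (forall i, P i -> loc_value (F i) (A i)) ->
  loc_value (\prod_(i <- r | P i) F i) (\prod_(i <- r | P i) A i).
Proof.
move=> FA; elim/big_rec2: _ => [|i a x Pi]; last by apply: loc_valueM; apply: FA.
exact: loc_value1.
Qed.

Lemma loc_valueX x a k : loc_value x a -> loc_value (x ^+ k) (a ^+ k).
Proof.
move=> xa; elim: k => [|k IH]; first exact: loc_value1.
by rewrite !exprS; apply: loc_valueM.
Qed.

Lemma loc_valueXz x a (k : int) : a != 0 -> loc_value x a -> loc_value (x ^ k) (a ^ k).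
Proof.
move=> a0 xa; case: k => k; first exact: loc_valueX.
by rewrite NegzE -!exprnN; apply: loc_valueV; rewrite ?expf_neq0 //; apply: loc_valueX.
Qed.

Lemma loc_value_gexp (a : O) (d : int_group_ring galT) :
  (forall s, phi (galZ s a) != 0) ->
  loc_value (gexp (val a) d) (pexp (fun s => phi (galZ s a)) d).
Proof.
move=> a0; apply: loc_value_prod => s _; apply: loc_valueXz => //.
exact: (loc_value_val (galZ s a)).
Qed.

(** Denominators allowed by [reduces_to] avoid all primes above [M], in particular the kernel of
    [phi]. *)
Lemma loc_value_reduces (M : nat) (x : L) (c : O) :
  M%:R = 0 :> K -> reduces_to M x c -> loc_value x (phi c).
Proof.
move=> MK [y [d [hd -> [w Ew]]]].
have d0 : phi d != 0.
  have := hd (kernel_ideal phi : prime_idealr O).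
  by rewrite !unfold_in rmorph_nat MK eqxx => /(_ isT).
exists y, d; split=> //; first by rewrite mulfVK // val_neq0.
by apply/eqP; rewrite eq_sym -subr_eq0 -rmorphM -rmorphB Ew rmorphM rmorph_nat MK mul0r.
Qed.

Lemma loc_value_conj_esym (x : L) (a : 'I_(p.-1 %/ 2) -> K) m :
  (forall i : 'I_(p.-1 %/ 2), loc_value (sigma i.+1%:Z x) (a i)) ->
  loc_value (conj_esym zeta p x m)
    (\sum_(I : {set 'I_(p.-1 %/ 2)} | #|I| == m) \prod_(i in I) a i).
Proof. by move=> xa; apply: loc_value_sum => I _; apply: loc_value_prod. Qed.

End Phi.

Lemma gal_gexp (a : L) (d : int_group_ring galT) (s : galT) : a != 0 ->
  s (gexp a d) = gexp a (d * igring_elt s).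
Proof.
move=> a0; rewrite -[RHS]/(pexp (fun g : galT => g a) _) pexp_mul; last first.
  by move=> g; rewrite fmorph_eq0.
rewrite /gexp rmorph_prod; apply: eq_bigr => g _.
by rewrite pexp_elt fmorphXz galM ?memvf.
Qed.

End Reduction.

(** * From the congruences (iii) to the prime divisors of [M] *)

Section CongruencesToPrime.
Variables (L : splittingFieldType rat) (zeta : L) (p : nat).
Hypotheses (hp : prime p) (hzeta : p.-primitive_root zeta).
Hypothesis hL : <<1; zeta>>%VS = fullv.

Local Notation galT := (gal_of {:L}).
Local Notation O := (Zring zeta).
Local Notation sigma := (sigma zeta).
Local Notation chi := (chi hzeta).
Local Notation galZ := (galZ hzeta).
Local Notation zetaZ := (zetaZ zeta).
Local Notation sigmaE := (sigmaE hp hzeta).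

Variables (n M f : nat) (S : seq int) (pi u v : O).
Hypotheses (hp_odd : odd p) (hn : (1 <= n)%N).
Hypothesis hpi : u * pi + v * M%:R = 1.
Hypothesis hf : f.-primitive_root (M%:R : 'F_p).
Hypothesis cS : all (fun i => coprimez i p) S.

Lemma reduction_unit (K : fieldType) (phi : {rmorphism O -> K}) (s : galT) :
  M%:R = 0 :> K -> phi (galZ s pi) != 0.
Proof.
move=> MK; have := congr1 phi (congr1 (galZ s) hpi).
rewrite !(rmorphD, rmorphM, rmorph1, rmorph_nat) /= MK mulr0 addr0 => E.
by apply: contra_eq_neq E => ->; rewrite mulr0 eq_sym oner_eq0.
Qed.

Lemma chi_mod_neq0 (s : galT) : (chi s %% p)%N != 0%N.
Proof.
have := chi_coprime hzeta s; rewrite coprime_sym prime_coprime //.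
Qed.

(** Both pairs are the roots of one quadratic polynomial with constant term 1. *)
Lemma root_pair_eq (K : fieldType) (z z' w w' : K) :
  z * z' = 1 -> w * w' = 1 -> z + z' = w + w' -> z = w \/ z = w'.
Proof.
move=> zz ww E; have : (z - w) * (z - w') = 0.
  have -> : (z - w) * (z - w') = z * z - z * (w + w') + w * w' by ring.
  by rewrite -E ww mulrDr zz; ring.
by move/eqP; rewrite mulf_eq0 !subr_eq0 => /orP[] /eqP; [left | right].
Qed.

Lemma prime_divisor_order (q : nat) : prime q -> (q %| M)%N ->
  (forall m : nat, (1 <= m <= p.-1 %/ 2)%N ->
     congr_mod zeta M (T_ p n M f S pi n.-1 m) (U_ zeta p m)) ->
  (q ^ p.-1 = 1 %[mod p ^ n])%N.
Proof.
move=> pq qM hTU; have [K [phi qK]] := reduction_exists hp hzeta pq.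
have cqp : coprime q p by apply: coprime_dvdl qM _; apply: order_coprime hf.
have qchar : q \in [pchar K] by rewrite inE pq qK eqxx.
have pK : p%:R != 0 :> K.
  by rewrite -(dvdn_pcharf qchar) -prime_coprime.
have MK : M%:R = 0 :> K by apply/eqP; rewrite -(dvdn_pcharf qchar).
pose F s := phi (galZ s pi); have F0 s : F s != 0 by apply: reduction_unit.
have pi0 : val pi != 0.
  by apply: (val_neq0 (phi := phi)); have := F0 1%g; rewrite /F galZ1.
set e := tau_exponent zeta p n M f S.
set P := (p ^ n.-1)%N.
(* The reduction of the conjugate by [s] of [t_] at [n - 1]; its second term comes from [bar]. *)
pose a (s : galT) := pexp F (e * igring_elt s) ^+ P +
  pexp F (e * igring_elt (sigma (-1)) * igring_elt s) ^+ P.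
have aP (s : galT) : loc_value phi (s (t_ p n M f S pi n.-1)) (a s).
  rewrite /t_ rmorphD !rmorphXn /= /bar /tau !gal_gexp //.
  by apply: loc_valueD; apply: loc_valueX; apply: loc_value_gexp.
pose zz := zetaZ + galZ (sigma (-1)) zetaZ.
pose b (s : galT) := phi (galZ s zz).
have bP (s : galT) : loc_value phi (s (zeta + bar zeta zeta)) (b s).
  exact: (loc_value_val phi (galZ s zz)).
pose r := (p.-1 %/ 2)%N.
have r0 : (0 < r)%N.
  by rewrite /r divn2 half_gt0; case: (p) hp hp_odd => [|[|[]]].
(* Index 0 stands for [sigma 1], the identity. *)
pose i0 := Ordinal r0.
pose A (i : 'I_r) := a (sigma i.+1%:Z); pose B (i : 'I_r) := b (sigma i.+1%:Z).
have esymE m : (m <= r)%N ->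
    \sum_(I : {set 'I_r} | #|I| == m) \prod_(i in I) A i =
    \sum_(I : {set 'I_r} | #|I| == m) \prod_(i in I) B i.
  (* The hypothesis starts at [m = 1]; for [m = 0] only the empty set contributes, on both sides. *)
  case: (posnP m) => [-> _|m0 mr].
    by apply: eq_bigr => I; rewrite cards_eq0 => /eqP->; rewrite !big_set0.
  have [|c Tc Uc] := hTU m; first by rewrite m0.
  transitivity (phi c).
    apply/esym; apply: loc_value_inj (loc_value_reduces phi MK Tc) _.
    by apply: loc_value_conj_esym => i; apply: aP.
  apply: loc_value_inj (loc_value_reduces phi MK Uc) _.
  by apply: loc_value_conj_esym => i; apply: bP.
(* The monic polynomials with roots [A i] and with roots [B i] have equal coefficients, so [A i0] is
   one of the [B i]. *)
have /eqP : \prod_(i < r) (A i0 - B i) = 0.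
  rewrite prod_sub_esym.
  under eq_bigr => m _ do rewrite -(esymE m (ltn_ord m)).
  by rewrite -prod_sub_esym; apply/eqP/prodf_eq0; exists i0; rewrite ?subrr.
move/prodf_eq0 => [i _]; rewrite subr_eq0 => /eqP.
rewrite /A /a /= (sigma1 hp hzeta hL) !mulr1.
set z := pexp F e ^+ P; set z' := _ ^+ P => Ezw.
have zz' : z * z' = 1.
  rewrite /z /z' -exprMn -pexpD // -{1}[e]mulr1 -mulrDr.
  by rewrite /e (tau_exponent_bar hp hzeta hL hf) // pexp0 expr1n.
have [s Es] : exists s : galT, z = phi zetaZ ^+ chi s.
  move: Ezw; rewrite /B /b /zz rmorphD rmorphD => Ezw.
  have ww : phi (galZ (sigma i.+1) zetaZ) * phi (galZ (sigma i.+1) (galZ (sigma (-1)) zetaZ)) = 1.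
    rewrite -!rmorphM (_ : zetaZ * _ = 1) ?rmorph1 //; apply: val_inj.
    rewrite val_ZringM /= sigmaE ?coprimezN1 // -[X in X * _]expr1z -expfzDr ?subrr //.
    exact: (zeta_neq0 hp hzeta).
  have [->|->] := root_pair_eq zz' ww Ezw.
    by exists (sigma i.+1); rewrite galZ_zeta rmorphXn.
  by exists (sigma (-1) * sigma i.+1)%g; rewrite -galZM galZ_zeta rmorphXn.
have z1 : z != 1.
  by rewrite Es; exact: (reduction_zetaX hzeta phi (chi_mod_neq0 s) pK).
have zp : z ^+ p = 1.
  by rewrite Es -exprM mulnC exprM (prim_expr_order (reduction_prim hp hzeta phi pK)) expr1n.
have Pp : (P * p = p ^ n)%N by rewrite /P -expnSr prednK.
set t := pexp F e in z z' zz' Ezw Es z1 zp *.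
have tpn : t ^+ (p ^ n) = 1 by rewrite -Pp exprM.
have qp1 : (q ^ p.-1 = 1 %[mod p])%N by rewrite -totient_prime // Euler_exp_totient.
have tq : t ^+ (q ^ p.-1) = t.
  rewrite /t /pexp -prodrXl; apply: eq_bigr => g _.
  by rewrite exprnP exprzAC -exprnP (reduction_frobenius_id hp hzeta).
have t0 : t != 0 by apply: pexp_unit.
have q0 : (0 < q ^ p.-1)%N by rewrite expn_gt0 prime_gt0.
have tq1 : t ^+ (q ^ p.-1 - 1) = 1.
  by apply: (mulfI t0); rewrite -exprS mulr1 subn1 prednK.
have pn0 : (0 < p ^ n)%N by rewrite expn_gt0 prime_gt0.
have [m pm] := prim_order_exists pn0 tpn.
(* The order of [t] is [p ^ j] with [j <= n]; for [j < n], the power [z] of [t] would be 1. *)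
case/(dvdn_pfactor _ _ hp) => j; rewrite leq_eqVlt => /predU1P[-> mpn|jn mpj].
  by apply/eqP; rewrite eqn_mod_dvd // -mpn (prim_order_dvd pm) tq1.
suff : z == 1 by rewrite (negPf z1).
by rewrite /z -(prim_order_dvd pm) mpj dvdn_exp2l // -ltnS prednK.
Qed.

End CongruencesToPrime.

(** * Calculus of residue classes modulo [M] *)

Section ReducesTo.
Variables (L : splittingFieldType rat) (zeta : L) (p : nat).
Hypotheses (hp : prime p) (hzeta : p.-primitive_root zeta).
Hypothesis hL : <<1; zeta>>%VS = fullv.

Local Notation galT := (gal_of {:L}).
Local Notation O := (Zring zeta).
Local Notation sigma := (sigma zeta).
Local Notation galZ := (galZ hzeta).

Variable M : nat.
Hypothesis M_gt1 : (1 < M)%N.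

Lemma reduces_to_val (c : O) : reduces_to M (val c) c.
Proof.
exists c, 1; split=> [P _||]; first by rewrite idealr1.
  by rewrite rmorph1 divr1.
by exists 0; rewrite mulr1 subrr mulr0.
Qed.

(** A prime ideal above [M] is needed to exclude 0; the kernel of a reduction at a prime factor of
    [M] is one. *)
Lemma denominator_neq0 (d : O) :
  (forall P : prime_idealr O, M%:R \in (P : {pred O}) -> d \notin (P : {pred O})) ->
  val d != 0.
Proof.
move=> hd; have [K [phi qK]] := reduction_exists hp hzeta (pdiv_prime M_gt1).
have MK : M%:R = 0 :> K.
  by have /dvdnP[k ->] := pdiv_dvd M; rewrite natrM qK mulr0.
apply/eqP => d0; have := hd (kernel_ideal phi : prime_idealr O).
rewrite !unfold_in rmorph_nat MK eqxx => /(_ isT).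
by rewrite (_ : d = 0) ?rmorph0 ?eqxx //; apply: val_inj.
Qed.

Lemma reduces_toD x x' c c' : reduces_to M x c -> reduces_to M x' c' ->
  reduces_to M (x + x') (c + c' : O).
Proof.
move=> [y [d [hd -> [z Ez]]]] [y' [d' [hd' -> [z' Ez']]]].
have d0 := denominator_neq0 hd; have d'0 := denominator_neq0 hd'.
exists (y * d' + y' * d), (d * d'); split=> [P PM||].
- by rewrite prime_idealrM negb_or hd ?hd'.
- by rewrite val_ZringD !val_ZringM addf_div // [val y' * _]mulrC.
exists (z * d' + z' * d).
have -> : y * d' + y' * d - (c + c') * (d * d') =
  (y - c * d) * d' + (y' - c' * d') * d by ring.
by rewrite Ez Ez' -!mulrA -mulrDr.
Qed.

Lemma reduces_toM x x' c c' : reduces_to M x c -> reduces_to M x' c' ->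
  reduces_to M (x * x') (c * c' : O).
Proof.
move=> [y [d [hd -> [z Ez]]]] [y' [d' [hd' -> [z' Ez']]]].
exists (y * y'), (d * d'); split=> [P PM||].
- by rewrite prime_idealrM negb_or hd ?hd'.
- by rewrite !val_ZringM mulf_div.
exists (z * y' + c * d * z').
have -> : y * y' - c * c' * (d * d') =
  (y - c * d) * y' + c * d * (y' - c' * d') by ring.
by rewrite Ez Ez'; ring.
Qed.

Lemma reduces_to_sum (I : Type) (r : seq I) (P : pred I) (F : I -> L) (C : I -> O) :
  (forall i, P i -> reduces_to M (F i) (C i)) ->
  reduces_to M (\sum_(i <- r | P i) F i) (\sum_(i <- r | P i) C i).
Proof.
move=> FC; elim/big_rec2: _ => [|i a x Pi]; last by apply: reduces_toD; apply: FC.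
by have := reduces_to_val 0; rewrite rmorph0.
Qed.

Lemma reduces_to_prod (I : Type) (r : seq I) (P : pred I) (F : I -> L) (C : I -> O) :
  (forall i, P i -> reduces_to M (F i) (C i)) ->
  reduces_to M (\prod_(i <- r | P i) F i) (\prod_(i <- r | P i) C i).
Proof.
move=> FC; elim/big_rec2: _ => [|i a x Pi]; last by apply: reduces_toM; apply: FC.
by have := reduces_to_val 1; rewrite rmorph1.
Qed.

Lemma reduces_to_gal (s : galT) x c : reduces_to M x c -> reduces_to M (s x) (galZ s c).
Proof.
move=> [y [d [hd -> [z Ez]]]]; exists (galZ s y), (galZ s d); split=> [P PM||].
- apply: (hd (comap_ideal (galZ s) P : prime_idealr O)).
  by rewrite [_ \in _]/(galZ s M%:R \in (P : {pred O})) rmorph_nat.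
- by rewrite fmorph_div.
by exists (galZ s z); rewrite -rmorphM -rmorphB Ez rmorphM rmorph_nat.
Qed.

Lemma reduces_to_conj_esym x c m : reduces_to M x c ->
  reduces_to M (conj_esym zeta p x m)
    (\sum_(I : {set 'I_(p.-1 %/ 2)} | #|I| == m) \prod_(i in I) galZ (sigma i.+1%:Z) c).
Proof.
move=> xc; apply: reduces_to_sum => I _; apply: reduces_to_prod => i _.
exact: reduces_to_gal.
Qed.

End ReducesTo.

(** * Independence of the symmetric functions from the root of unity *)

Section ConjEsym.
Variables (L : splittingFieldType rat) (zeta : L) (p : nat).
Hypotheses (hp : prime p) (hzeta : p.-primitive_root zeta).
Hypothesis hL : <<1; zeta>>%VS = fullv.

Local Notation sigma := (sigma zeta).
Local Notation gal_commute := (gal_commute hzeta hL).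

Hypothesis hp_odd : odd p.

(** Multiplication by [k] permutes [1, ..., r] up to sign modulo [p], and the sign does not matter
    since [sigma_{-1}] fixes [x]. *)
Lemma conj_esym_sigma (x : L) (k m : nat) : coprime k p -> sigma (-1) x = x ->
  conj_esym zeta p (sigma k%:Z x) m = conj_esym zeta p x m.
Proof.
move=> ckp barx; set r := (p.-1 %/ 2)%N.
have pr : p = (r + r)%N.+1.
  by have := odd_double_half p; rewrite hp_odd /r divn2; lia.
have ci (i : 'I_r) : coprime i.+1 p.
  by rewrite coprime_sym prime_coprime // gtnNdvd //; have := ltn_ord i; lia.
(* The congruence of squares forgets the sign and suffices for injectivity: squares of distinct
   numbers in [1, ..., r] differ modulo [p]. *)
have [h hP hsq] : exists2 h : 'I_r -> 'I_r,
    forall i : 'I_r, sigma i.+1%:Z (sigma k%:Z x) = sigma (h i).+1%:Z x &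
    forall i : 'I_r, ((k * i.+1) ^ 2 = (h i).+1 ^ 2 %[mod p])%N.
  suff /fin_all_exists2[h h1 h2] : forall i : 'I_r, exists2 j : 'I_r,
      sigma i.+1%:Z (sigma k%:Z x) = sigma j.+1%:Z x &
      ((k * i.+1) ^ 2 = j.+1 ^ 2 %[mod p])%N by exists h.
  move=> i.
  have E : sigma i.+1%:Z (sigma k%:Z x) = sigma (k * i.+1)%N%:Z x.
    by rewrite PoszM (sigmaM hp hzeta hL (a := k) (b := i.+1)) ?galM ?memvf ?coprimezE ?ci.
  have ck : coprime (k * i.+1) p by rewrite coprimeMl ckp ci.
  set v := ((k * i.+1) %% p)%N.
  have v0 : (0 < v)%N.
    rewrite lt0n; apply: contraTneq ck => v0.
    by rewrite coprime_sym prime_coprime // negbK; apply/eqP.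
  have vp : (v < p)%N by rewrite ltn_pmod ?prime_gt0.
  (* One of [v] and [p - v] lies in [1, ..., r]; its predecessor is taken because index [j] stands
     for [j + 1]. *)
  have [vr|rv] := leqP v r.
    have v1 : (v.-1 < r)%N by rewrite prednK.
    exists (Ordinal v1); rewrite /= prednK //; last by rewrite /v modnXm.
    rewrite E (sigma_mod hp hzeta hL (a := (k * i.+1)%N) (b := v)) ?coprimezE //.
    by rewrite !modz_nat /v modn_mod.
  have v1 : ((p - v).-1 < r)%N by lia.
  have pv0 : (0 < p - v)%N by rewrite subn_gt0.
  exists (Ordinal v1); rewrite /= prednK //; last first.
    rewrite -modnXm -/v -(modnMDl (p - v) (v ^ 2)) -[RHS](modnMDl v).
    by congr (_ %% _)%N; nia.
  have cpv : coprimez (p - v)%N p.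
    by rewrite coprimezE coprime_sym prime_coprime // gtnNdvd // ltn_subrL v0 prime_gt0.
  rewrite E (_ : sigma (k * i.+1)%N = sigma (- (p - v)%N%:Z)).
    by rewrite (sigmaN hp hzeta hL) // gal_commute galM ?memvf // barx.
  apply: (sigma_mod hp hzeta hL); rewrite ?coprimezE //.
  apply/eqP; rewrite eqz_mod_dvd opprK -PoszD dvdzE /=.
  by rewrite {1}(divn_eq (k * i.+1) p) -/v -addnA subnKC ?dvdn_addl ?dvdn_mull // ltnW.
have h_inj : injective h.
  move=> i j hij; have := hsq i; rewrite hij -(hsq j) !expnMn => /eqP.
  wlog ij : i j {hij} / (i <= j)%N.
    by move=> W E; case: (leqP i j) => [/W ->|/ltnW /W ->] //; rewrite eq_sym.
  rewrite eq_sym eqn_mod_dvd; last by rewrite leq_mul2l leq_exp2r // ltnS ij orbT.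
  rewrite -mulnBr Gauss_dvdr; last by rewrite coprimeXr // coprime_sym.
  rewrite subn_sqr Euclid_dvdM // => /orP[|] pd; apply/val_inj/eqP => /=.
    have := ltn_ord j; have := ltn_ord i; move: pd; rewrite subSS.
    case: (posnP (j - i)%N) => [|/dvdn_leq H /H]; lia.
  by move/dvdn_leq: pd; have := ltn_ord j; have := ltn_ord i; lia.
rewrite /conj_esym [RHS](reindex_inj (imset_inj h_inj)) /=.
apply: eq_big => [I|I _]; first by rewrite card_imset.
rewrite big_imset /=; last by move=> i j _ _; apply: h_inj.
by apply: eq_bigr => i _; apply: hP.
Qed.

End ConjEsym.

(** * Prime ideals above a prime [M] *)

Section PrimeModulus.
Variables (L : splittingFieldType rat) (zeta : L) (p : nat).
Hypotheses (hp : prime p) (hzeta : p.-primitive_root zeta).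
Hypothesis hL : <<1; zeta>>%VS = fullv.

Local Notation galT := (gal_of {:L}).
Local Notation O := (Zring zeta).
Local Notation sigma := (sigma zeta).
Local Notation chi := (chi hzeta).
Local Notation galZ := (galZ hzeta).
Local Notation zetaZ := (zetaZ zeta).

Variables (M f : nat).
Hypothesis prM : prime M.
Hypothesis hf : f.-primitive_root (M%:R : 'F_p).
Variables (K : fieldType) (phi : {rmorphism O -> K}).
Hypothesis MK : M%:R = 0 :> K.

Lemma pchar_reduction : M \in [pchar K].
Proof. by rewrite inE prM MK eqxx. Qed.

Lemma reduction_p_neq0 : p%:R != 0 :> K.
Proof. by rewrite -(dvdn_pcharf pchar_reduction) -prime_coprime // (order_coprime hp hf). Qed.

Let prim_zK : p.-primitive_root (phi zetaZ) := reduction_prim hp hzeta phi reduction_p_neq0.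

Lemma reduction_galZ (s : galT) (u : {poly int}) :
  phi (galZ s (map_poly intr u).[zetaZ]) = (map_poly intr u).[phi zetaZ ^+ chi s].
Proof. by rewrite !rmorph_Zring /= galZ_zeta rmorphXn. Qed.

Lemma Zring_small_horner (x : O) :
  exists2 u : {poly int}, (size u < p)%N & x = (map_poly intr u).[zetaZ].
Proof.
have [u Eu] := Zring_horner x; have mon := Cyclotomic_monic p.
exists (Pdiv.Ring.rmodp u 'Phi_p).
  have := Pdiv.Ring.ltn_rmodpN0 u (monic_neq0 mon).
  by rewrite size_Cyclotomic totient_prime // prednK ?prime_gt0.
rewrite {1}Eu {1}(Pdiv.RingMonic.rdivp_eq mon u) rmorphD rmorphM hornerD hornerM.
rewrite [X in _ * X](_ : _ = 0) ?mulr0 ?add0r //; apply: val_inj.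
by rewrite val_hornerZ /= (root_Cyclotomic hzeta).
Qed.

(* An integer polynomial of degree less than p - 1 vanishing in K at the p - 1
   primitive p-th roots of unity is divisible by M. *)
Lemma reduction_inter (x : O) :
  (forall s : galT, phi (galZ s x) = 0) -> principal_ideal M%:R x.
Proof.
move=> x0; have [u su Eu] := Zring_small_horner x.
pose rs := [seq phi zetaZ ^+ k | k <- iota 1 p.-1].
have p1 : p.-1.+1 = p by rewrite prednK // prime_gt0.
have u0 : map_poly intr u = 0 :> {poly K}.
  apply/eqP; apply: contraLR su => u0; rewrite -leqNgt -p1.
  have := @max_poly_roots _ _ rs u0; rewrite size_map size_iota => lt_u.
  apply: leq_trans (lt_u _ _) (size_poly _ _).
    apply/allP => z /mapP[k]; rewrite mem_iota add1n p1 => /andP[k0 kp] ->{z}.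
    have ck : coprimez k p.
      by rewrite coprimezE coprime_sym prime_coprime // gtnNdvd.
    have := x0 (sigma k); rewrite Eu reduction_galZ => E; apply/eqP.
    rewrite -[RHS]E; congr _.[_]; apply/eqP; rewrite (eq_prim_root_expr prim_zK).
    by have := chi_sigma hp hzeta ck; rewrite !modz_nat => -[->].
  rewrite map_inj_in_uniq ?iota_uniq // => i j; rewrite !mem_iota add1n p1.
  move=> /andP[_ ip] /andP[_ jp] /eqP; rewrite (eq_prim_root_expr prim_zK).
  by rewrite !modn_small // => /eqP.
have dvd i : (M %| u`_i)%Z.
  rewrite (dvdz_pcharf pchar_reduction).
  by have := congr1 (fun v : {poly K} => v`_i) u0; rewrite coef_map coef0 => /eqP.
pose v := \poly_(i < size u) (u`_i %/ M)%Z.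
exists (map_poly intr v).[zetaZ].
have uv : u = M%:Z *: v.
  apply/polyP => i; rewrite coefZ coef_poly; case: ltnP => [_|ui].
    by rewrite mulrC divzK.
  by rewrite mulr0 nth_default.
by rewrite Eu {1}uv map_polyZ hornerZ /= pmulrn.
Qed.

Lemma reduction_fermat (x : O) : phi x ^+ (M ^ f) = phi x.
Proof.
apply: (reduction_frobenius_id hp hzeta) => //; apply/eqP.
by rewrite (order_eq_mod hp hf f 0) modnn mod0n.
Qed.

Lemma reduction_fermat1 (x : O) : phi x != 0 -> phi x ^+ (M ^ f - 1) = 1.
Proof.
move=> x0; apply: (mulfI x0); rewrite -exprS mulr1 subn1 prednK ?reduction_fermat //.
by rewrite expn_gt0 prime_gt0.
Qed.

Lemma frobenius_ideal (x : O) : principal_ideal M%:R (x ^+ (M ^ f) - x).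
Proof.
apply: reduction_inter => s.
by rewrite rmorphB rmorphXn rmorphB rmorphXn /= reduction_fermat subrr.
Qed.

(** For [x] a polynomial in [zeta], both sides are its value at the same power of [phi zetaZ]:
    [sigma_M] is the Frobenius modulo [M]. *)
Lemma reduction_galZ_frobenius (s : galT) (x : O) j :
  phi (galZ (sigma M%:Z ^+ j * s)%g x) = phi (galZ s x) ^+ (M ^ j).
Proof.
have [u Eu] := Zring_horner x; rewrite Eu !reduction_galZ.
rewrite (reduction_frobenius _ _ _ prM MK); congr _.[_].
rewrite -exprM; apply/eqP; rewrite (eq_prim_root_expr prim_zK).
have cM := order_coprimez hp hf.
rewrite chiM // -(sigmaX hp hzeta hL) //; apply/eqP.
have cMj : coprimez (M%:Z ^+ j) p by rewrite coprimezXl.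
have := chi_sigma hp hzeta cMj; rewrite -rmorphXn !modz_nat => -[E].
by rewrite -modnMml E modnMml mulnC.
Qed.

Lemma prime_ideal_unit (P : prime_idealr O) (x : O) : M%:R \in (P : {pred O}) ->
  x \notin (P : {pred O}) -> x ^+ (M ^ f - 1) - 1 \in (P : {pred O}).
Proof.
move=> MP xP; have [y Ey] := frobenius_ideal x.
have Mf : (0 < M ^ f)%N by rewrite expn_gt0 prime_gt0.
have : x * (x ^+ (M ^ f - 1) - 1) \in (P : {pred O}).
  rewrite mulrBr mulr1 -exprS subn1 prednK // Ey mulrC.
  exact: idealMr.
by rewrite prime_idealrM (negPf xP).
Qed.

(** Says that [P] is the kernel of [phi o s]; primes above [M] are thus indexed, with repetition, by
    Galois automorphisms. *)
Definition lies_over (P : prime_idealr O) (s : galT) : Prop :=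
  forall x : O, (x \in (P : {pred O})) = (phi (galZ s x) == 0).

(** Maximality of [P]: an element outside [P] has its power [M ^ f - 1] congruent to 1 modulo [P],
    so it cannot reduce to 0. *)
Lemma lies_over_sub (P : prime_idealr O) (s : galT) : M%:R \in (P : {pred O}) ->
  (forall x, x \in (P : {pred O}) -> phi (galZ s x) = 0) -> lies_over P s.
Proof.
move=> MP sub x; apply/idP/eqP => [/sub //|x0]; apply: contra_eqT x0 => xP.
have := sub _ (prime_ideal_unit MP xP); rewrite rmorphB rmorphXn rmorph1 rmorphB rmorphXn rmorph1 /=.
apply: contra_eq_neq => ->; rewrite expr0n subn_eq0 leqNgt.
have -> : (1 < M ^ f)%N.
  by rewrite -{1}(exp1n f) ltn_exp2r ?prime_gt1 // (prim_order_gt0 hf).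
by rewrite sub0r oppr_eq0 oner_eq0.
Qed.

(* Otherwise P contains an element taken to 1 by every phi o s, and such an
   element is congruent to 1 modulo M. *)
Lemma lies_over_exists (P : prime_idealr O) : M%:R \in (P : {pred O}) ->
  exists s, lies_over P s.
Proof.
move=> MP; apply: contrapT => no.
have [x xP x0] : exists2 x : galT -> O, forall s, x s \in (P : {pred O}) &
    forall s, phi (galZ s (x s)) != 0.
  suff /fin_all_exists2[x h1 h2] : forall s : galT, exists2 x : O, x \in (P : {pred O}) &
     phi (galZ s x) != 0 by exists x.
  move=> s; apply: contrapT => nos; apply: no; exists s; apply: lies_over_sub => // x xP.
  by apply/eqP; apply: contrapT => /negP xs; apply: nos; exists x.
(* This stays in [P] and is sent to 1 by [phi o s]; the element wanted is 1 minus the product of all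
   [1 - e s]. *)
pose e s := x s ^+ (M ^ f - 1).
have Mf : (0 < M ^ f - 1)%N.
  by rewrite subn_gt0 -{1}(exp1n f) ltn_exp2r ?prime_gt1 // (prim_order_gt0 hf).
have eP s : e s \in (P : {pred O}) by rewrite /e -(prednK Mf) exprSr idealMr.
have [y Ey] : principal_ideal M%:R (\prod_(s : galT) (1 - e s)).
  apply: reduction_inter => s; rewrite !rmorph_prod (bigD1 s) //=.
  rewrite rmorphB rmorphXn rmorph1 rmorphB rmorphXn rmorph1 /= reduction_fermat1 //.
  by rewrite subrr mul0r.
have : \prod_(s : galT) (1 - e s) \in (P : {pred O}) by rewrite Ey mulrC idealMr.
rewrite prime_ideal_prod => /hasP[s _] /= esP.
have : 1 - e s + e s \in (P : {pred O}) by rewrite rpredD.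
by rewrite subrK idealr1.
Qed.

End PrimeModulus.

(** * Residue fields and fibres above a prime [M] *)

Section ResidueField.
Variables (L : splittingFieldType rat) (zeta : L) (p : nat).
Hypotheses (hp : prime p) (hzeta : p.-primitive_root zeta).
Hypothesis hL : <<1; zeta>>%VS = fullv.

Local Notation galT := (gal_of {:L}).
Local Notation O := (Zring zeta).
Local Notation sigma := (sigma zeta).
Local Notation chi := (chi hzeta).
Local Notation galZ := (galZ hzeta).
Local Notation zetaZ := (zetaZ zeta).

Variables (M f : nat).
Hypothesis prM : prime M.
Hypothesis hf : f.-primitive_root (M%:R : 'F_p).
Variables (K : fieldType) (phi : {rmorphism O -> K}).
Hypothesis MK : M%:R = 0 :> K.

Let pchar_red := pchar_reduction prM MK.
Let prim_zK : p.-primitive_root (phi zetaZ) :=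
  reduction_prim hp hzeta phi (reduction_p_neq0 hp prM hf MK).
Local Notation lies_over := (@lies_over L zeta p hzeta K phi).

Lemma zeta_frobenius_inj (s : galT) :
  {in gtn f &, injective (fun j => (phi zetaZ ^+ chi s) ^+ (M ^ j))}.
Proof.
move=> i j; rewrite !inE => lif ljf /eqP.
have ps : p.-primitive_root (phi zetaZ ^+ chi s).
  by rewrite (prim_root_exp_coprime _ prim_zK) chi_coprime.
rewrite (eq_prim_root_expr ps) (order_eq_mod hp hf) !modn_small // => /eqP.
done.
Qed.

Lemma horner_zeta_frobenius (s : galT) (u : {poly int}) j :
  (map_poly intr u).[phi zetaZ ^+ chi s] = 0 ->
  (map_poly intr u).[(phi zetaZ ^+ chi s) ^+ (M ^ j)] = 0.
Proof.
move=> u0; rewrite -(reduction_frobenius _ _ _ prM MK) u0 expr0n.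
by rewrite expn_eq0 eqn0Ngt prime_gt0.
Qed.

(** A zero propagates to its [f] distinct Frobenius conjugates, too many for the degree. *)
Lemma small_horner_zeta_eq0 (s : galT) (u : {poly int}) : (size u <= f)%N ->
  (map_poly intr u).[phi zetaZ ^+ chi s] = 0 -> map_poly intr u = 0 :> {poly K}.
Proof.
move=> su u0; apply/eqP; apply: contraLR su => un0; rewrite -ltnNge.
pose rs := [seq (phi zetaZ ^+ chi s) ^+ (M ^ j) | j <- iota 0 f].
have := @max_poly_roots _ _ rs un0; rewrite size_map size_iota => lt_u.
apply: leq_trans (lt_u _ _) (size_poly _ _).
  by apply/allP => z /mapP[j _ ->]; apply/eqP; apply: horner_zeta_frobenius.
rewrite map_inj_in_uniq ?iota_uniq // => i j; rewrite !mem_iota.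
by move=> ? ?; apply: zeta_frobenius_inj.
Qed.

(** The cardinal is bounded on both sides. The polynomial [v], needed to count the automorphisms
    over [P], comes from equality of the bounds. *)
Lemma residue_card_lies_over (P : prime_idealr O) (s : galT) q :
  lies_over P s -> residue_card P q ->
  q = (M ^ f)%N /\ exists v : {poly int},
    [/\ size v = f.+1, v \is monic & (map_poly intr v).[phi zetaZ ^+ chi s] = 0].
Proof.
move=> Ps [h [g hK gK]].
have piE (x y : O) : (\pi_{ideal_quot P} x == \pi_{ideal_quot P} y)%qT =
    (phi (galZ s x) == phi (galZ s y)).
  by rewrite -Quotient.idealrBE Ps !rmorphB /= subr_eq0.
have f0 := prim_order_gt0 hf.
have leq_q : (q <= M ^ f)%N.
  (* Distinct classes have distinct images in [K], all roots of [X^(M^f) - X]. *)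
  pose rs := codom (fun i : 'I_q => phi (galZ s (generic_quotient.repr (h i)))).
  have Mf1 : (1 < M ^ f)%N by rewrite -{1}(exp1n f) ltn_exp2r ?prime_gt1.
  have sX : size ('X^(M ^ f) - 'X : {poly K}) = (M ^ f).+1.
    by rewrite size_polyDl size_polyXn // size_polyN size_polyX ltnS.
  have X0 : 'X^(M ^ f) - 'X != 0 :> {poly K} by rewrite -size_poly_eq0 sX.
  have := @max_poly_roots _ _ rs X0; rewrite size_codom card_ord sX ltnS; apply.
    apply/allP => z /codomP[i ->]; rewrite /root !hornerE.
    by rewrite (reduction_fermat hp hzeta prM hf) // subrr.
  rewrite /rs /codom /image_mem map_inj_in_uniq ?enum_uniq // => i j _ _ /eqP.
  by rewrite -piE !generic_quotient.reprK => /eqP /(can_inj hK).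
(* Polynomials of degree below [f] with coefficients in [0, ..., M - 1]: by [small_horner_zeta_eq0]
   their values at [zeta] are distinct modulo [P]. *)
pose w (c : {ffun 'I_f -> 'I_M}) : {poly int} := \poly_(i < f) (nth 0 [seq (val (c j))%:Z | j : 'I_f] i).
have wE c (i : 'I_f) : (w c)`_i = c i.
  rewrite coef_poly ltn_ord (nth_map i) ?size_enum_ord //.
  by rewrite nth_ord_enum.
pose G c := g (\pi_{ideal_quot P} (map_poly intr (w c)).[zetaZ])%qT.
have G_inj : injective G.
  move=> c c' /(can_inj gK)/eqP; rewrite piE !(reduction_galZ hzeta) => E.
  have : map_poly intr (w c - w c') = 0 :> {poly K}.
    apply: (@small_horner_zeta_eq0 s).
      by rewrite (leq_trans (size_polyD _ _)) // size_polyN geq_max !size_poly.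
    by rewrite rmorphB hornerD hornerN (eqP E) subrr.
  move=> w0; apply/ffunP => i; apply/val_inj/eqP => /=.
  have := congr1 (fun v : {poly K} => v`_i) w0.
  rewrite coef_map coef0 coefB !wE /= intrB -!pmulrn => /eqP; rewrite subr_eq0.
  wlog le : c c' {E w0} / (c i <= c' i)%N.
    move=> W Ec; case: (leqP (c i) (c' i)) => [le|/ltnW le]; first exact: W le Ec.
    by rewrite eq_sym; apply: W le _; rewrite eq_sym.
  rewrite eq_sym -subr_eq0 -natrB // -(dvdn_pcharf pchar_red) => d.
  rewrite eqn_leq le /= -subn_eq0; case: (posnP (c' i - c i)%N) d => // dpos /(dvdn_leq dpos).
  by have := ltn_ord (c' i); lia.
have geq_q : (M ^ f <= q)%N.
  by have := leq_card G G_inj; rewrite card_ffun !card_ord.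
have Eq : q = (M ^ f)%N by apply/eqP; rewrite eqn_leq leq_q.
split=> //.
(* The bounds agree, so [G] is onto: [zeta ^ f] is congruent to the value of some [w c], and [v] is
   ['X^f - w c]. *)
have cardle : (#|'I_q| <= #|{ffun 'I_f -> 'I_M}|)%N by rewrite card_ffun !card_ord.
have /codomP[c Ec] := inj_card_onto G_inj cardle (g (\pi_{ideal_quot P} (zetaZ ^+ f))%qT).
have sw : (size (- w c)%R < size ('X^f : {poly int}))%N.
  by rewrite size_polyN size_polyXn ltnS size_poly.
exists ('X^f - w c); split.
- by rewrite size_polyDl // size_polyXn.
- by rewrite monicE lead_coefDl // lead_coefXn.
move/(can_inj gK): Ec => /eqP; rewrite piE (reduction_galZ hzeta).
rewrite !rmorphXn /= galZ_zeta rmorphXn => /eqP E.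
by rewrite rmorphB /= map_polyXn hornerD hornerN hornerXn E subrr.
Qed.

(** The automorphisms over [P] are the [sigma_M ^ j * s]: another one would give [v] a root besides
    the [f] Frobenius conjugates that exhaust its degree. *)
Lemma card_lies_over (P : prime_idealr O) (v : {poly int}) (s : galT) :
  lies_over P s -> size v = f.+1 -> v \is monic ->
  (map_poly intr v).[phi zetaZ ^+ chi s] = 0 ->
  #|[set t : galT | `[< lies_over P t >]]| = f.
Proof.
move=> Ps sv mv v0; have cM := order_coprimez hp hf.
pose h (j : 'I_f) := (sigma M%:Z ^+ j * s)%g.
have chi_h j : (phi zetaZ ^+ chi s) ^+ (M ^ j) = phi zetaZ ^+ chi (sigma M%:Z ^+ j * s)%g.
  rewrite -[RHS](_ : phi (galZ (sigma M%:Z ^+ j * s)%g zetaZ) = _); last first.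
    by rewrite galZ_zeta rmorphXn.
  by rewrite (reduction_galZ_frobenius hp hzeta hL prM hf) // galZ_zeta rmorphXn.
have -> : [set t | `[< lies_over P t >]] = h @: setT.
  apply/setP => t; rewrite inE; apply/asboolP/imsetP => [Pt|[j _ ->] x]; last first.
    rewrite Ps (reduction_galZ_frobenius hp hzeta hL prM hf) // expf_eq0.
    by rewrite expn_gt0 prime_gt0.
  have vt : (map_poly intr v).[phi zetaZ ^+ chi t] = 0.
    apply/eqP; rewrite -(reduction_galZ hzeta) -Pt Ps (reduction_galZ hzeta).
    exact/eqP.
  pose rs := [seq (phi zetaZ ^+ chi s) ^+ (M ^ j) | j <- iota 0 f].
  have [/mapP[j]|tn] := boolP (phi zetaZ ^+ chi t \in rs).
    rewrite mem_iota add0n => /= jf; rewrite chi_h => /eqP.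
    rewrite (eq_prim_root_expr prim_zK) => /eqP /(chi_inj hL) ->.
    by exists (Ordinal jf).
  have vn0 : map_poly intr v != 0 :> {poly K}.
    by apply/monic_neq0/monic_map.
  have := @max_poly_roots _ _ (phi zetaZ ^+ chi t :: rs) vn0.
  rewrite /= size_map size_iota => lt_v.
  have : (f.+1 < size (map_poly intr v : {poly K}))%N.
    apply: lt_v; last first.
      rewrite tn map_inj_in_uniq ?iota_uniq // => i j; rewrite !mem_iota.
      by move=> ? ?; apply: zeta_frobenius_inj.
    rewrite /root vt eqxx /=; apply/allP => z /mapP[j _ ->]; apply/eqP.
    exact: horner_zeta_frobenius.
  by rewrite ltnNge -sv size_poly.
rewrite card_imset ?cardsT ?card_ord // => i j hij; apply: val_inj.
apply: (@zeta_frobenius_inj s); rewrite ?inE ?ltn_ord //.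
by rewrite !chi_h -/(h i) -/(h j) hij.
Qed.

End ResidueField.

(** * Products over the representatives used in [gamma] *)

Section CosetRepresentatives.
Variables (L : splittingFieldType rat) (zeta : L) (p : nat).
Hypotheses (hp : prime p) (hzeta : p.-primitive_root zeta).
Hypothesis hL : <<1; zeta>>%VS = fullv.

Local Notation galT := (gal_of {:L}).
Local Notation sigma := (sigma zeta).
Local Notation chi := (chi hzeta).
Local Notation gal_commute := (gal_commute hzeta hL).

Variables (M f : nat).
Hypothesis hf : f.-primitive_root (M%:R : 'F_p).

Let cM : coprimez M p := order_coprimez hp hf.

Lemma card_gal : #|'Gal({:L} / 1)%g| = p.-1.
Proof.
pose h (i : 'I_p.-1) := sigma i.+1%:Z.
have ci (i : 'I_p.-1) : coprimez i.+1%:Z p.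
  rewrite coprimezE coprime_sym prime_coprime // gtnNdvd //=.
  by have := ltn_ord i; have := prime_gt0 hp; lia.
have chi_h i : (chi (h i) = i.+1 %[mod p])%N.
  by have := chi_sigma hp hzeta (ci i); rewrite !modz_nat => -[].
have lt_p (i : 'I_p.-1) : (i.+1 < p)%N by have := ltn_ord i; have := prime_gt0 hp; lia.
have h_inj : injective h.
  move=> i j hij; apply: val_inj; have := chi_h i.
  by rewrite hij chi_h !modn_small ?lt_p // => -[].
rewrite -[p.-1]card_ord -(card_codom h_inj); apply/esym/eq_card => s.
rewrite gal_mem; apply/codomP.
have s0 := chi_mod_neq0 hp hzeta s.
have sp : ((chi s %% p).-1 < p.-1)%N.
  by have := ltn_pmod (chi s) (prime_gt0 hp); lia.
exists (Ordinal sp); apply: (chi_inj (hzeta := hzeta) hL).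
by rewrite chi_h /= prednK ?lt0n // modn_mod.
Qed.

Lemma card_subH : #|subH zeta M f| = f.
Proof.
rewrite card_imset ?card_ord // => i j E; apply: val_inj.
have ci (k : 'I_f) : coprimez (M%:Z ^+ k) p by rewrite coprimezXl.
have := chi_sigma hp hzeta (ci i); rewrite E (chi_sigma hp hzeta (ci j)).
rewrite -!rmorphXn !modz_nat => -[/eqP]; rewrite (order_eq_mod hp hf).
by rewrite !modn_small // => /eqP.
Qed.

Lemma subHE : subH zeta M f = <[sigma M%:Z]>%g.
Proof.
apply/eqP; rewrite eqEcard card_subH; apply/andP; split.
  apply/subsetP => s /imsetP[j _ ->].
  by rewrite (sigmaX hp hzeta hL) // mem_cycle.
rewrite -orderE dvdn_leq ?(prim_order_gt0 hf) // order_dvdn.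
by rewrite (sigma_order hp hzeta hL hf).
Qed.

(** The size of [S] equals the index of [N], so no automorphism is listed twice and the product
    along [S] is the product over the transversal. *)
Lemma coset_reps_prod (R : comNzRingType) (w : galT -> R) (N : {group galT}) k S :
  coset_reps zeta p k N S -> (k * #|N|)%N = p.-1 ->
  \prod_g w g = \prod_(i <- S) \prod_(h in N) w (h * sigma i)%g.
Proof.
move=> [sS _ trX] kN; set X := [set s in _] in trX.
have sNG : N \subset 'Gal({:L} / 1)%g by apply/subsetP => s _; apply: gal_mem.
have -> : \prod_g w g = \prod_(g in 'Gal({:L} / 1)%g) w g.
  by apply: eq_bigl => g; rewrite gal_mem.
rewrite (prod_transversal _ sNG trX) -(big_map (fun i => sigma i) predT (fun x => \prod_(h in N) w (h * x)%g)).
have uS : uniq [seq sigma i | i <- S].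
  apply/card_uniqP; rewrite size_map sS -cardsE -/X (card_transversal trX).
  have := Lagrange sNG; rewrite -/(#|'Gal({:L} / 1) : N|%g).
  by rewrite card_gal -kN mulnC => /eqP; rewrite eqn_pmul2r ?cardG_gt0 // => /eqP.
by rewrite (big_uniq _ uS); apply: eq_bigl => s; rewrite inE.
Qed.

(* The square serves the odd case, where the product over g is compared with the
   product of w g * w (sigma_{-1} g). *)
Lemma prod_gamma_reps (R : comNzRingType) (w : galT -> R) (S : seq int) :
  odd p -> gamma_reps zeta p M f S -> (forall g, w (sigma M%:Z * g)%g = w g) ->
  exists T : seq int, [/\ all (fun i => coprimez i p) T,
    gamma zeta f S = \sum_(i <- T) igring_elt (sigma i)^-1%g *~ i &
    (\prod_g w g) ^+ 2 = (\prod_(i <- T) w (sigma i)) ^+ (f * 2)].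
Proof.
move=> podd; have f0 := prim_order_gt0 hf; have fp := order_dvd hp hf.
rewrite /gamma_reps subHE /gamma => + wM.
have wH h g : h \in <[sigma M%:Z]>%g -> w (h * g)%g = w g.
  move=> /cycleP[i ->]; elim: i => [|i IH]; first by rewrite expg0 mul1g.
  by rewrite expgS -mulgA wM.
have cH : #|<[sigma M%:Z]>%g| = f by rewrite -subHE card_subH.
case: ifP => fo hS; last first.
  exists S; split=> //; first by case: hS.
  rewrite (coset_reps_prod w hS) ?cH ?divnK // exprM; congr (_ ^+ 2).
  rewrite -prodrXl; apply: eq_bigr => i _; rewrite -[in RHS]cH -prodr_const.
  by apply: eq_bigr => h hH; rewrite wH.
have cS : all (fun i => coprimez i p) S by case: hS.
(* Adjoining the opposites gives [gamma] for odd [f] the shape it has for even [f]. *)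
exists (S ++ [seq - i | i <- S]); split.
- by rewrite all_cat cS all_map; apply/allP => i /(allP cS) /=; rewrite coprimeNz.
- rewrite big_cat big_map /= -big_split; apply: eq_bigr => i _ /=.
  by rewrite mulrzBl mulrNz.
have cA : #|<[sigma (-1)]>%g| = 2%N.
  have s1 : sigma (-1) != 1%g.
    apply/eqP => s1; have := chi_sigma hp hzeta (coprimezN1 p); rewrite s1.
    have /eqP := chi1 hzeta; rewrite -eqz_nat -!modz_nat => /eqP -> /eqP.
    rewrite eqz_mod_dvd opprK => /dvdn_leq; rewrite /= => /(_ isT).
    by case: (p) hp podd => [|[|[|]]].
  by rewrite -orderE; apply: nt_prime_order => //; rewrite expgS expg1 (sigmaN1K hp hzeta hL).
have cAH : commute (sigma (-1)) (sigma M%:Z) by apply: gal_commute.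
set A := <[sigma (-1)]>%G; set H := <[sigma M%:Z]>%G.
have AHE : (A <*> H)%G = (A * H)%g :> {set galT}.
  by apply: cent_joinEr; rewrite centsC; apply: cents_cycle.
have cAHf : #|(A <*> H)%G| = (2 * f)%N.
  rewrite AHE TI_cardMg ?cA ?cH //; apply: coprime_TIg.
  by rewrite cA cH coprime2n.
have hS' : coset_reps zeta p (p.-1 %/ f %/ 2) (A <*> H)%G S by rewrite AHE.
(* Unlike [w], this is invariant under [sigma_{-1}] as well, hence constant on the cosets that [S]
   represents. *)
pose w2 g := w g * w (sigma (-1) * g)%g.
have w2A g : w2 (sigma (-1) * g)%g = w2 g.
  by rewrite /w2 mulgA (sigmaN1K hp hzeta hL) mul1g mulrC.
have w2H h g : h \in H -> w2 (h * g)%g = w2 g.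
  by move=> hH; rewrite /w2 wH // !mulgA -(gal_commute h) -!mulgA wH.
have w2N h g : h \in (A <*> H)%G -> w2 (h * g)%g = w2 g.
  rewrite [h \in _](_ : _ = (h \in (A * H)%g)); last by rewrite -AHE.
  case/mulsgP => a' h' /cycleP[i ->] hH ->; rewrite -mulgA.
  elim: i => [|i IH]; first by rewrite expg0 mul1g w2H.
  by rewrite expgS -mulgA w2A IH.
have feven : (2 * f %| p.-1)%N.
  rewrite Gauss_dvd ?coprime2n // fp andbT dvdn2.
  by rewrite -oddS prednK ?prime_gt0.
have := coset_reps_prod w2 hS'; rewrite cAHf -divnMA mulnC [(f * 2)%N]mulnC mulnC divnK // => /(_ erefl).
have -> : \prod_g w2 g = (\prod_g w g) ^+ 2.
  rewrite big_split expr2 /=; congr (_ * _).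
  by rewrite [RHS](reindex_inj (mulgI (sigma (-1)))).
move=> ->.
rewrite big_cat big_map /= -big_split -prodrXl; apply: eq_big_seq => i /(allP cS) ci.
rewrite [w (sigma (- i))](_ : _ = w (sigma (-1) * sigma i)%g); last first.
  by rewrite (sigmaN hp hzeta hL ci) (gal_commute (sigma i)).
rewrite -/(w2 (sigma i)) -cAHf -prodr_const.
by apply: eq_bigr => h hN; rewrite w2N.
Qed.

End CosetRepresentatives.

(** * The power residue symbol seen through the reductions *)

Section ResidueSymbol.
Variables (L : splittingFieldType rat) (zeta : L) (p : nat).
Hypotheses (hp : prime p) (hzeta : p.-primitive_root zeta).
Hypothesis hL : <<1; zeta>>%VS = fullv.

Local Notation galT := (gal_of {:L}).
Local Notation O := (Zring zeta).
Local Notation sigma := (sigma zeta).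
Local Notation chi := (chi hzeta).
Local Notation galZ := (galZ hzeta).
Local Notation zetaZ := (zetaZ zeta).

Variables (M f : nat).
Hypothesis prM : prime M.
Hypothesis hf : f.-primitive_root (M%:R : 'F_p).
Variables (K : fieldType) (phi : {rmorphism O -> K}).
Hypothesis MK : M%:R = 0 :> K.
Variables (pi u v : O).
Hypothesis hpi : u * pi + v * M%:R = 1.
Variables (k : nat) (P : 'I_k -> prime_idealr O) (c : 'I_k -> O).
Hypothesis hfact : forall x : O, principal_ideal M%:R x <->
  (\big[@ideal_mul O/@unit_ideal O]_(i < k) (fun y => y \in (P i : {pred O}))) x.
Hypothesis hres : forall i, prime_power_residue p (P i) pi (c i).

Let prim_zK : p.-primitive_root (phi zetaZ) :=
  reduction_prim hp hzeta phi (reduction_p_neq0 hp prM hf MK).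
Local Notation lies_over := (@lies_over L zeta p hzeta K phi).

Let M_in i : M%:R \in (P i : {pred O}).
Proof.
apply: (mem_ideal_prod (P := P) (mem_index_enum i)); apply/hfact.
by exists 1; rewrite mulr1.
Qed.

Let principal_reduction (s : galT) (x : O) : principal_ideal M%:R x -> phi (galZ s x) = 0.
Proof. by case=> y ->; rewrite !rmorphM !rmorph_nat MK mul0r. Qed.

(** Otherwise each [P i] contains an element not killed by [phi o s]; their product lies in the
    ideal of [M], which is killed, although a product of nonzero elements of [K] is not 0. *)
Lemma factor_exists (s : galT) : exists i, lies_over (P i) s.
Proof.
apply: contrapT => no.
have [x xP x0] : exists2 x : 'I_k -> O, forall i, x i \in (P i : {pred O}) &
    forall i, phi (galZ s (x i)) != 0.
  suff /fin_all_exists2[x h1 h2] : forall i, exists2 x : O, x \in (P i : {pred O}) &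
     phi (galZ s x) != 0 by exists x.
  move=> i; apply: contrapT => nos; apply: no; exists i.
  apply: (lies_over_sub hp prM hf MK) => // x xP.
  by apply/eqP; apply: contrapT => /negP xs; apply: nos; exists x.
have /hfact/(principal_reduction s) := prod_in_ideal_prod (index_enum 'I_k) xP.
rewrite !rmorph_prod => /eqP/prodf_eq0[i _] /=.
by rewrite (negPf (x0 i)).
Qed.

(* Some e outside ker (phi o s) carries that kernel into (M); a repeated factor
   would make a power of e divisible by M. *)
Lemma factor_unique (s : galT) i j : lies_over (P i) s -> lies_over (P j) s -> i = j.
Proof.
move=> Pi Pj; apply: contrapT => ij.
pose D := [pred l | `[< lies_over (P l) s >]].
have [x xP x0] : exists2 x : 'I_k -> O,
    forall l, ~~ D l -> x l \in (P l : {pred O}) & forall l, phi (galZ s (x l)) != 0.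
  suff /fin_all_exists2[x h1 h2] : forall l, exists2 x : O, ~~ D l -> x \in (P l : {pred O}) &
     phi (galZ s x) != 0 by exists x.
  move=> l; have [Dl|/asboolPn nDl] := boolP (D l).
    by exists 1; rewrite // !rmorph1 oner_eq0.
  apply: contrapT => nos; apply: nDl.
  apply: (lies_over_sub hp prM hf MK) => // x xP.
  by apply/eqP; apply: contrapT => /negP xs; apply: nos; exists x.
pose e := \prod_l x l.
have e0 : phi (galZ s e) != 0.
  by rewrite !rmorph_prod; apply/prodf_neq0 => l _; apply: x0.
(* For each [t] some factor is the kernel of [phi o t]; that factor contains [y] if it also lies
   over [s], and [e] otherwise. *)
have De l y : D l -> y \in (P l : {pred O}) -> principal_ideal M%:R (e * y).
  move=> /asboolP Dl yP; apply: (reduction_inter (phi := phi) hp prM hf MK) => t.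
  have [l' Pl'] := factor_exists t; have [/asboolP Dl'|nDl'] := boolP (D l').
    rewrite !rmorphM /=; apply/eqP; rewrite mulf_eq0; apply/orP; right.
    by rewrite -Pl' Dl' -Dl.
  rewrite !rmorphM /=; apply/eqP; rewrite mulf_eq0; apply/orP; left.
  by rewrite -Pl' prime_ideal_prod; apply/hasP; exists l'; rewrite ?mem_index_enum //; apply: xP.
(* Counting factors for the element [M] itself gives [e ^+ cnt * M = M ^+ cnt * z]; with [cnt >= 2],
   cancelling one [M] puts a power of [e] in the ideal of [M]. *)
have : principal_ideal M%:R (M%:R : O) by exists 1; rewrite mulr1.
move=> /hfact /(ideal_prod_count De)[z]; set cnt := count D _ => E.
have cnt2 : (1 < cnt)%N.
  have -> : cnt = #|D| by rewrite /cnt -sum1_count sum1_card.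
  apply/card_gt1P; exists i, j; split; [exact/asboolP|exact/asboolP|exact/eqP].
have M0 : (M%:R : O) != 0.
  rewrite -(inj_eq val_inj) rmorph_nat rmorph0 -(rmorph_nat (in_alg L)) fmorph_eq0 pnatr_eq0.
  by rewrite -lt0n prime_gt0.
have : M%:R * (e ^+ cnt - M%:R * (M%:R ^+ (cnt - 2) * z)) = 0 :> O.
  apply/eqP; rewrite mulrBr subr_eq0; apply/eqP; rewrite [LHS]mulrC E.
  by rewrite {1}(_ : cnt = (cnt - 2).+2) ?exprS ?mulrA //; lia.
case/Zring_mul_eq0 => [/eqP|]; first by rewrite (negPf M0).
move/(congr1 (phi \o galZ s)); rewrite /= !(rmorphB, rmorphM, rmorphXn, rmorph_nat, rmorph0) /=.
rewrite MK mul0r subr0 => /eqP; rewrite expf_eq0 (negPf e0) andbF.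
by [].
Qed.

Local Notation N := ((M ^ f - 1) %/ p)%N.

Lemma p_dvd_order : (p %| M ^ f - 1)%N.
Proof.
rewrite -eqn_mod_dvd ?expn_gt0 ?prime_gt0 //.
by rewrite (order_eq_mod hp hf f 0) modnn mod0n.
Qed.

Lemma pi_notin i : pi \notin (P i : {pred O}).
Proof.
apply/negP => piP; have : u * pi + v * M%:R \in (P i : {pred O}).
  by apply: rpredD; apply: idealMr => //; apply: M_in.
by rewrite hpi idealr1.
Qed.

Lemma residue_root i : c i ^+ p = 1.
Proof. by have := (hres i).2; rewrite (negPf (pi_notin i)) => -[q _ []]. Qed.

Lemma residue_root_expr i : exists m, c i = zetaZ ^+ m.
Proof.
have cp : (val (c i)) ^+ p = 1.
  have := congr1 val (residue_root i).
  by rewrite (rmorphXn (val : {rmorphism O -> L})).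
have [m Em] := prim_rootP hzeta cp; exists m; apply: val_inj.
by rewrite (rmorphXn (val : {rmorphism O -> L})).
Qed.

Lemma residue_galZ (s : galT) i : phi (galZ s (c i)) = phi (c i) ^+ chi s.
Proof.
have [m ->] := residue_root_expr i.
by rewrite !rmorphXn /= galZ_zeta !rmorphXn /= exprAC.
Qed.

(** The residue field has [M ^ f] elements, so the exponent defining the symbol is [N]. *)
Lemma residue_congr (s : galT) i : lies_over (P i) s ->
  phi (galZ s pi) ^+ N = phi (galZ s (c i)).
Proof.
move=> Ps; have := (hres i).2; rewrite (negPf (pi_notin i)) => -[q hq [_ /eqP]].
have [-> _] := residue_card_lies_over hp prM hf MK Ps hq.
by rewrite -Quotient.idealrBE Ps !rmorphB !rmorphXn /= subr_eq0 => /eqP.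
Qed.

Lemma card_fiber i : #|[set s : galT | `[< lies_over (P i) s >]]| = f.
Proof.
have [s Ps] := lies_over_exists hp hzeta prM hf phi MK (M_in i).
have := (hres i).2; rewrite (negPf (pi_notin i)) => -[q hq _].
have [_ [w [sw mw w0]]] := residue_card_lies_over hp prM hf MK Ps hq.
exact: (card_lies_over hp hL prM hf MK Ps sw mw w0).
Qed.

(* Constant on the fibres of s |-> ker (phi o s), with value phi (c i) over P i. *)
Definition symbol_at (s : galT) : K := phi (galZ s pi) ^+ (N * chi s^-1%g).

(** The exponent [chi s^-1] undoes the action of [s] on the root of unity [c i]. *)
Lemma symbol_atE (s : galT) i : lies_over (P i) s -> symbol_at s = phi (c i).
Proof.
move=> Ps; rewrite /symbol_at exprM (residue_congr Ps) residue_galZ -exprM.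
have [m ->] := residue_root_expr i; rewrite rmorphXn /=.
rewrite -exprM; apply/eqP; rewrite (eq_prim_root_expr prim_zK).
have /eqP := chiM hzeta s s^-1%g; rewrite mulgV => /eqP E.
by rewrite -modnMmr -E (chi1 hzeta) modnMmr muln1.
Qed.

Lemma symbol_at_unity (s : galT) : symbol_at s ^+ p = 1.
Proof.
have [i Pi] := factor_exists s; rewrite (symbol_atE Pi).
by rewrite -rmorphXn residue_root rmorph1.
Qed.

Lemma symbol_at_expr (s : galT) : phi (galZ s pi) ^+ N = symbol_at s ^+ chi s.
Proof.
have [i Pi] := factor_exists s.
by rewrite (symbol_atE Pi) (residue_congr Pi) residue_galZ.
Qed.

Lemma symbol_at_frobenius (s : galT) : symbol_at (sigma M%:Z * s)%g = symbol_at s.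
Proof.
have [i Pi] := factor_exists s; rewrite (symbol_atE Pi); apply: symbol_atE => x.
rewrite Pi -[sigma M]expg1 (reduction_galZ_frobenius hp hzeta hL prM hf) //.
by rewrite expf_eq0 expn1 prime_gt0.
Qed.

(** Each [s] lies under exactly one factor, and each factor is reached by exactly [f]
    automorphisms. *)
Lemma prod_symbol_at : \prod_s symbol_at s = phi (\prod_i c i) ^+ f.
Proof.
rewrite rmorph_prod -prodrXl.
transitivity (\prod_s \prod_(i | `[< lies_over (P i) s >]) phi (c i)).
  apply: eq_bigr => s _; have [i Pi] := factor_exists s.
  rewrite (big_pred1 i) ?(symbol_atE Pi) // => j.
  by apply/asboolP/eqP => [Pj|->//]; apply: factor_unique Pj Pi.
rewrite (exchange_big_dep predT) //=; apply: eq_bigr => i _.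
rewrite -[in RHS](card_fiber i) -prodr_const.
by apply: eq_bigl => s; rewrite inE.
Qed.

End ResidueSymbol.

(** * Divisibility of the cyclotomic value by [p ^ n] *)

Section CyclotomicValue.

Variables (p n M f : nat).
Hypotheses (hp : prime p) (hf : f.-primitive_root (M%:R : 'F_p)).

(** The cofactor of [M ^ f - 1] in [M ^ (p - 1) - 1] is a sum of [g = (p - 1) / f] powers of
    [M ^ f], congruent to [g] modulo [p] and so prime to [p]. *)
Lemma pow_dvd_order : (M ^ p.-1 = 1 %[mod p ^ n])%N -> (p ^ n %| M ^ f - 1)%N.
Proof.
move=> hM; have f0 := prim_order_gt0 hf; have /dvdnP[g Eg] := order_dvd hp hf.
have g0 : (0 < g)%N.
  rewrite lt0n; apply/eqP => g0; have := prime_gt1 hp; rewrite -(prednK (prime_gt0 hp)).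
  by rewrite Eg g0.
have M0 : (0 < M)%N.
  have := order_coprime hp hf; case: (M) => // ; rewrite /coprime gcd0n => /eqP p1.
  by have := prime_gt1 hp; rewrite p1.
have Mf0 : (0 < M ^ f)%N by rewrite expn_gt0 M0.
move/eqP: hM; rewrite eqn_mod_dvd ?expn_gt0 ?M0 // Eg mulnC expnM !subn1 predn_exp.
rewrite Gauss_dvdl //; apply: coprimeXl; rewrite prime_coprime //.
have Mf1 : (M ^ f = 1 %[mod p])%N.
  by apply/eqP; rewrite (order_eq_mod hp hf f 0) modnn mod0n.
have -> : (p %| \sum_(i < g) (M ^ f) ^ i)%N = (p %| g)%N.
  rewrite /dvdn; congr (_ == _); rewrite -modn_summ.
  rewrite (eq_bigr (fun=> 1 %% p)%N) => [|i _]; last by rewrite -modnXm Mf1 modnXm exp1n.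
  by rewrite modn_summ sum1_card card_ord.
rewrite gtnNdvd // -(prednK (prime_gt0 hp)) ltnS Eg.
by rewrite leq_pmulr.
Qed.

Lemma prod_Cyclotomic_value : (0 < f)%N ->
  ('Phi_f).[M%:Z] * \prod_(d <- divisors f | (d < f)%N) ('Phi_d).[M%:Z] = M%:Z ^+ f - 1.
Proof.
move=> f0; have <- : ('X^f - 1).[M%:Z] = M%:Z ^+ f - 1 by rewrite !hornerE.
rewrite -prod_Cyclotomic // horner_prod (bigD1_seq f) ?divisors_uniq ?divisors_id //=.
congr (_ * _); rewrite big_seq_cond [RHS]big_seq_cond; apply: eq_bigl => d.
rewrite -dvdn_divisors //; case: (boolP (d %| f)%N) => //= ddvf.
by rewrite ltn_neqAle dvdn_leq // andbT.
Qed.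

(** For [d < f] the value of ['Phi_d] divides [M ^ d - 1], which is prime to [p] since [f] is the
    order of [M]. Hence the division in [tau_exponent] is exact. *)
Lemma Cyclotomic_value_dvd : (M ^ p.-1 = 1 %[mod p ^ n])%N ->
  ((p ^ n)%N %| ('Phi_f).[M%:Z])%Z.
Proof.
move=> hM; have f0 := prim_order_gt0 hf.
have M0 : (0 < M)%N.
  have := order_coprime hp hf; case: (M) => // ; rewrite /coprime gcd0n => /eqP p1.
  by have := prime_gt1 hp; rewrite p1.
have : ((p ^ n)%N %| M%:Z ^+ f - 1)%Z.
  have -> : M%:Z ^+ f - 1 = (M ^ f - 1)%N%:Z.
    by rewrite -subzn ?expn_gt0 ?M0 // rmorphXn.
  by rewrite dvdzE /= pow_dvd_order.
rewrite -prod_Cyclotomic_value // Gauss_dvdzl //.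
rewrite rmorphXn coprimezXl // big_seq_cond.
elim/big_ind: _ => [|a b ca cb|d /andP[]]; first by rewrite coprimezE coprimen1.
  by rewrite coprimezMr ca.
rewrite -dvdn_divisors // => ddvf df; have d0 : (0 < d)%N by apply: dvdn_gt0 ddvf.
rewrite coprimezE prime_coprime //; apply/negP => pd.
have : (p %| M%:Z ^+ d - 1)%Z.
  have -> : M%:Z ^+ d - 1 = ('X^d - 1).[M%:Z] by rewrite !hornerE.
  by rewrite -prod_Cyclotomic // (big_rem d) ?divisors_id //= hornerM dvdz_mulr.
have -> : M%:Z ^+ d - 1 = (M ^ d)%N%:Z - 1%N%:Z by rewrite rmorphXn.
rewrite -eqz_mod_dvd !modz_nat eqz_nat (order_eq_mod hp hf d 0) mod0n modn_small //.
by rewrite eqn0Ngt d0.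
Qed.

End CyclotomicValue.

(** When translation by [s] acts as the [M]-th power, a polynomial in [s] acts as its value at
    [M]. *)
Lemma pexp_frobenius (gT : finGroupType) (K : fieldType) (M : nat) (s : gT)
    (us : seq {poly int}) (G : gT -> K) :
  (forall g, G g != 0) -> (forall g, G (g * s)%g = G g ^+ M) ->
  pexp G (\prod_(u <- us) (map_poly intr u).[igring_elt s]) =
    G 1%g ^ (\prod_(u <- us) u.[M%:Z]).
Proof.
move=> G0 GM.
(* The family is quantified inside [good] because the product case applies the hypothesis on [x] to
   a transformed family. *)
pose good (x : int_group_ring gT) (k : int) := forall G : gT -> K,
  (forall g, G g != 0) -> (forall g, G (g * s)%g = G g ^+ M) -> pexp G x = G 1%g ^ k.
have goodD x y a b : good x a -> good y b -> good (x + y) (a + b).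
  by move=> gx gy H H0 HM; rewrite pexpD // gx // gy // expfzDr.
have goodM x y a b : good x a -> good y b -> good (x * y) (a * b).
  move=> gx gy H H0 HM; rewrite pexp_mul //.
  rewrite (eq_pexp (F2 := fun g => H g ^ b)); last first.
    by move=> g; rewrite gy ?mulg1 // => h; rewrite mulgA HM.
  rewrite gx => [|g|g]; first by rewrite exprz_exp mulrC.
    exact: expfz_neq0.
  by rewrite HM !exprnP exprzAC.
have good1 : good 1 1 by move=> H H0 HM; rewrite -igring_elt1 pexp_elt expr1z.
have goodC (k : int) : good k%:~R k.
  by move=> H H0 HM; rewrite pexp_mulrz good1 // expr1z.
have goods : good (igring_elt s) M%:Z.
  by move=> H H0 HM; rewrite pexp_elt -[s]mul1g HM exprnP.
have goodu u : good (map_poly intr u).[igring_elt s] u.[M%:Z].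
  elim/poly_ind: u => [|u c IH]; first by rewrite rmorph0 !horner0; apply: (goodC 0).
  rewrite rmorphD rmorphM /= map_polyX map_polyC !hornerMXaddC.
  by apply: goodD; [apply: goodM | apply: goodC].
suff : good (\prod_(u <- us) (map_poly intr u).[igring_elt s]) (\prod_(u <- us) u.[M%:Z]).
  by apply.
elim/big_rec2: _ => [|u k x _ gx]; first exact: good1.
exact: goodM.
Qed.

Lemma eq_of_exprs (K : fieldType) (x y : K) (p m : nat) :
  (0 < m)%N -> coprime m p -> x ^+ p = 1 -> y ^+ p = 1 -> x ^+ m = y ^+ m -> x = y.
Proof.
move=> m0 cmp xp yp xy; case: (egcdnP p m0) => km kn Ek _.
have E (z : K) : z ^+ p = 1 -> z ^+ m ^+ km = z.
  by move=> zp; rewrite -exprM mulnC Ek (eqP cmp) addn1 exprS mulnC exprM zp expr1n mulr1.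
by rewrite -(E x xp) -(E y yp) xy.
Qed.

(** * From primality to the congruence (ii) *)

Section PrimeToCongruence.
Variables (L : splittingFieldType rat) (zeta : L) (p : nat).
Hypotheses (hp : prime p) (hzeta : p.-primitive_root zeta).
Hypothesis hL : <<1; zeta>>%VS = fullv.

Local Notation galT := (gal_of {:L}).
Local Notation O := (Zring zeta).
Local Notation sigma := (sigma zeta).
Local Notation chi := (chi hzeta).
Local Notation galZ := (galZ hzeta).
Local Notation gal_commute := (gal_commute hzeta hL).

Variables (n M f : nat) (S : seq int) (pi u v : O).
Hypotheses (hp_odd : odd p) (hn : (1 <= n)%N).
Hypothesis hf : f.-primitive_root (M%:R : 'F_p).
Hypothesis hpi : u * pi + v * M%:R = 1.

(** Positive exponents go to the numerator [y], negative ones to the denominator [z]; conjugates of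
    [pi] avoid all primes above [M]. One pair serves all reductions at once. *)
Lemma gexp_fraction (d : int_group_ring galT) : exists y z : O,
  [/\ forall P : prime_idealr O, M%:R \in (P : {pred O}) -> z \notin (P : {pred O}),
      val z != 0 -> gexp (val pi) d = val y / val z &
      forall (K : fieldType) (phi : {rmorphism O -> K}), M%:R = 0 :> K ->
        phi y = pexp (fun t => phi (galZ t pi)) d * phi z].
Proof.
have piP (s : galT) (P : prime_idealr O) : M%:R \in (P : {pred O}) ->
    galZ s pi \notin (P : {pred O}).
  move=> MP; apply/negP => piP; have : galZ s (u * pi + v * M%:R) \in (P : {pred O}).
    by rewrite rmorphD !rmorphM rmorph_nat; apply: rpredD; apply: idealMr.
  by rewrite hpi rmorph1 idealr1.
rewrite /gexp /pexp; elim: (index_enum _) => [|s r [y [z [hz1 hz2 hz3]]]].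
  exists 1, 1; split=> [P _|_|K phi _]; first by rewrite idealr1.
    by rewrite big_nil rmorph1 divr1.
  by rewrite big_nil mul1r.
have ks (K : fieldType) (phi : {rmorphism O -> K}) : M%:R = 0 :> K -> phi (galZ s pi) != 0.
  exact: (reduction_unit hzeta hpi phi s).
case E: ((d : {ffun galT -> int}) s) => [k|k].
  exists (galZ s pi ^+ k * y), z; split=> // [z0|K phi MK].
    rewrite big_cons E -exprnP hz2 // val_ZringM mulrA; congr (_ * _ / _).
    by rewrite (rmorphXn (val : {rmorphism O -> L})).
  by rewrite big_cons E -exprnP rmorphM rmorphXn hz3 // mulrA.
exists y, (galZ s pi ^+ k.+1 * z); split=> [P MP|z0|K phi MK].
- rewrite prime_idealrM negb_or hz1 // andbT.
  by apply/negP => /prime_idealX; apply/negP; apply: piP.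
- move: z0; rewrite val_ZringM mulf_eq0 negb_or => /andP[p0 z0].
  rewrite big_cons E hz2 // invfM [RHS]mulrCA; congr (_ * _).
  by rewrite NegzE -exprnN (rmorphXn (val : {rmorphism O -> L})).
rewrite big_cons E rmorphM rmorphXn hz3 // NegzE -exprnN.
by rewrite mulrACA mulVf ?mul1r ?expf_neq0 ?ks.
Qed.

Hypothesis hS : gamma_reps zeta p M f S.
Hypothesis prM : prime M.
Hypothesis hM : (M ^ p.-1 = 1 %[mod p ^ n])%N.

Section Symbol.

Variables (K : fieldType) (phi : {rmorphism O -> K}).
Hypothesis MK : M%:R = 0 :> K.
Variables (k : nat) (P : 'I_k -> prime_idealr O) (c : 'I_k -> O).
Hypothesis hfact : forall x : O, principal_ideal M%:R x <->
  (\big[@ideal_mul O/@unit_ideal O]_(i < k) (fun y => y \in (P i : {pred O}))) x.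
Hypothesis hres : forall i, prime_power_residue p (P i) pi (c i).

(** This is the congruence (ii) seen through [phi o b], with the symbol of [pi] as the root of
    unity. *)
Lemma tau_symbol (b : galT) :
  pexp (fun t => phi (galZ b (galZ t pi))) (tau_exponent zeta p n M f S *~ (p ^ n.-1)%N) =
  phi (galZ b (\prod_i c i)).
Proof.
have f0 := prim_order_gt0 hf.
pose F (t : galT) := phi (galZ (t * b)%g pi).
have F0 (t : galT) : F t != 0 by exact: (reduction_unit hzeta hpi phi _ MK).
rewrite (eq_pexp (F2 := F)) => [|t]; last by rewrite /F galZM.
(* The inverse matches the [sigma_i^-1] occurring in [gamma]. *)
pose w (g : galT) := symbol_at hzeta M f phi pi (g^-1 * b)%g.
have symF := symbol_at_frobenius hp hzeta hL prM hf phi MK hpi hfact hres.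
have wM g : w (sigma M%:Z * g)%g = w g.
  rewrite /w invMg -mulgA -[LHS]symF mulgA (gal_commute (sigma M%:Z)).
  by rewrite -!mulgA (gal_commute b) mulKg.
have [T [cT gT wT]] := prod_gamma_reps hp hzeta hL hf hp_odd hS wM.
set N := ((M ^ f - 1) %/ p)%N.
pose Dv := \prod_(d <- divisors f | (d < f)%N) ('Phi_d).[M%:Z].
pose E := (('Phi_f).[M%:Z] %/ (p ^ n)%N%:Z)%Z * (p ^ n.-1)%N%:Z.
(* The cyclotomic values multiply to [M ^ f - 1], and [p ^ (n - 1)] against the division by [p ^ n]
   leaves the exponent [N] of the residue symbol. *)
have DvE : Dv * E = N%:Z.
  have p0 : p%:Z != 0 by rewrite eqz_nat -lt0n prime_gt0.
  apply: (mulIf p0); rewrite -PoszM divnK ?(p_dvd_order hp prM hf) //.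
  rewrite -mulrA /E -mulrA -PoszM -expnSr prednK // divzK ?Cyclotomic_value_dvd //.
  rewrite mulrC prod_Cyclotomic_value // -subzn ?expn_gt0 ?prime_gt0 //.
  by rewrite rmorphXn.
rewrite /tau_exponent -mulrzA pexp_mulrz -/E pexp_mul //.
rewrite (eq_pexp (F2 := fun g => F g ^ Dv)); last first.
  move=> g; rewrite /Dv.
  have Fg t : F (g * (t * sigma M%:Z))%g = F (g * t)%g ^+ M.
    rewrite /F (_ : (g * (t * sigma M%:Z) * b)%g = (sigma M%:Z ^+ 1 * (g * t * b))%g).
    by rewrite (reduction_galZ_frobenius hp hzeta hL prM hf) // expn1.
    by rewrite expg1 (gal_commute (sigma M%:Z)) -!mulgA (gal_commute b).
  have := pexp_frobenius [seq 'Phi_d | d <- [seq d <- divisors f | (d < f)%N]]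
    (fun t => F0 (g * t)%g) Fg.
  by rewrite !big_map !big_filter mulg1.
rewrite gT pexp_sum => [|g]; last exact: expfz_neq0.
pose W := \prod_(i <- T) w (sigma i).
have W_unit : W ^+ p = 1.
  rewrite /W -prodrXl big1 // => i _.
  exact: (symbol_at_unity hp hzeta prM hf phi MK hpi hfact hres).
(* Since [i] is [chi (sigma i)] modulo [p], the exponent [i * chi (sigma_i^-1 b)] becomes [chi b],
   the same for all [i]. *)
have -> : (\prod_(i <- T) pexp (fun g => F g ^ Dv) (igring_elt (sigma i)^-1%g *~ i)) ^ E =
    W ^+ chi b.
  rewrite /W -prodrXl.
  transitivity (\prod_(i <- T) (pexp (fun g => F g ^ Dv) (igring_elt (sigma i)^-1%g *~ i) ^ E)).
    elim: (T) => [|i r IH]; first by rewrite !big_nil exp1rz.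
    by rewrite !big_cons expfzMl IH.
  apply: eq_big_seq => i /(allP cT) ci.
  rewrite pexp_mulrz pexp_elt !exprz_exp [i * E]mulrC mulrA DvE -exprz_exp -exprnP.
  rewrite (symbol_at_expr hp hzeta prM hf phi MK hpi hfact hres) -/(w (sigma i)).
  rewrite exprnP exprz_exp [RHS]exprnP.
  apply: exprz_mod (prime_gt0 hp) _ _.
    exact: (symbol_at_unity hp hzeta prM hf phi MK hpi hfact hres).
  have := chiM hzeta (sigma i) ((sigma i)^-1 * b)%g; rewrite mulKVg => Ec.
  rewrite mulrC -modzMml -(chi_sigma hp hzeta ci) modzMml -PoszM.
  by rewrite !modz_nat Ec.
suff -> : W = phi (\prod_i c i).
  rewrite !rmorph_prod -prodrXl; apply: eq_bigr => i _.
  by rewrite /= (residue_galZ hzeta phi hpi hfact hres).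
have c_unit : phi (\prod_i c i) ^+ p = 1.
  rewrite rmorph_prod -prodrXl big1 // => i _.
  by rewrite -rmorphXn (residue_root hpi hfact hres) rmorph1.
(* As [p] is odd and [f] divides [p - 1], the power [2 f] is injective on [p]-th roots of unity. *)
apply: (@eq_of_exprs K _ _ p (f * 2)) => //; first by rewrite muln_gt0 f0.
  rewrite coprimeMl coprime2n hp_odd andbT.
  rewrite coprime_sym prime_coprime // gtnNdvd //.
  apply: leq_ltn_trans (dvdn_leq _ (order_dvd hp hf)) _.
    by have := prime_gt1 hp; lia.
  by rewrite prednK ?prime_gt0.
rewrite -wT exprM -(prod_symbol_at hp hzeta hL prM hf phi MK hpi hfact hres); congr (_ ^+ 2).
rewrite [RHS](reindex_inj invg_inj) [RHS](reindex_inj (mulgI b^-1%g)) /=.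
by apply: eq_bigr => g _; rewrite /w invMg invgK.
Qed.

End Symbol.

Lemma prime_congruence :
  (exists2 s : O, power_residue p (principal_ideal M%:R) pi s & s != 1) ->
  exists2 xi : L, p.-primitive_root xi &
    congr_mod zeta M (tau p n M f S pi ^+ (p ^ n.-1)) xi.
Proof.
case=> s [k [P [c [hfact hres Es]]]] s1.
have sp : s ^+ p = 1.
  by rewrite Es -prodrXl big1 // => i _; apply: (residue_root hpi hfact hres).
have xip : p.-primitive_root (val s).
  have vsp : (val s) ^+ p = 1.
    by have := congr1 val sp; rewrite (rmorphXn (val : {rmorphism O -> L})).
  have [m Em] := prim_rootP hzeta vsp.
  rewrite Em (prim_root_exp_coprime _ hzeta) coprime_sym prime_coprime //.
  apply: contra_neqN s1 => pm; apply: val_inj; rewrite Em rmorph1.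
  by apply/eqP; rewrite -(prim_order_dvd hzeta).
exists (val s) => //; exists s; last exact: reduces_to_val.
have -> : tau p n M f S pi ^+ (p ^ n.-1) =
    gexp (val pi) (tau_exponent zeta p n M f S *~ (p ^ n.-1)%N).
  by rewrite -[gexp _ _]/(pexp (fun g : galT => g (val pi)) _) pexp_mulrz -exprnP.
have [y [z [zP yz hyz]]] := gexp_fraction (tau_exponent zeta p n M f S *~ (p ^ n.-1)%N).
exists y, z; split=> //.
  by rewrite yz //; apply: (denominator_neq0 hp hzeta (prime_gt1 prM) zP).
have [K [phi MK]] := reduction_exists hp hzeta prM.
(* As [M] is prime, divisibility by [M] is tested at all [phi o b]. *)
apply: (reduction_inter (hzeta := hzeta) (phi := phi) hp prM hf MK) => b.
rewrite rmorphB rmorphM rmorphB rmorphM /=.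
have := hyz K (phi \o galZ b) MK; rewrite /= => ->.
by rewrite (tau_symbol phi MK hfact hres) -Es subrr.
Qed.

End PrimeToCongruence.

(** * From the congruence (ii) to the congruences (iii) *)

Section CongruenceToEsym.
Variables (L : splittingFieldType rat) (zeta : L) (p : nat).
Hypotheses (hp : prime p) (hzeta : p.-primitive_root zeta).
Hypothesis hL : <<1; zeta>>%VS = fullv.

Local Notation O := (Zring zeta).
Local Notation sigma := (sigma zeta).
Local Notation galZ := (galZ hzeta).
Local Notation sigmaE := (sigmaE hp hzeta).
Local Notation gal_commute := (gal_commute hzeta hL).

Variables (n M f : nat) (S : seq int) (pi : O).
Hypotheses (hp_odd : odd p) (M_gt1 : (1 < M)%N).

(** With [xi = sigma k zeta], [conj_esym_sigma] replaces [zeta] by [xi] in [U_]; both sides then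
    reduce to the same expression in the common class [c]. *)
Lemma congruence_esym (xi : L) (m : nat) : p.-primitive_root xi ->
  congr_mod zeta M (tau p n M f S pi ^+ (p ^ n.-1)) xi ->
  congr_mod zeta M (T_ p n M f S pi n.-1 m) (U_ zeta p m).
Proof.
move=> xip [c tc xc].
have [k Ek] := prim_rootP hzeta (prim_expr_order xip).
have ck : coprime k p by rewrite -(prim_root_exp_coprime _ hzeta) -Ek.
have Exi : xi = sigma (k : nat)%:Z zeta by rewrite Ek sigmaE // -exprnP.
have hbar x d : reduces_to M x d ->
    reduces_to M (x + bar zeta x) (d + galZ (sigma (-1)) d : O).
  by move=> xd; apply: (reduces_toD hp hzeta M_gt1) => //; apply: reduces_to_gal.
exists (\sum_(I : {set 'I_(p.-1 %/ 2)} | #|I| == m)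
    \prod_(i in I) galZ (sigma i.+1%:Z) (c + galZ (sigma (-1)) c)).
  rewrite /T_ /t_ -[bar _ _ ^+ _]rmorphXn.
  exact: (reduces_to_conj_esym hp hzeta M_gt1 _ (hbar _ _ tc)).
rewrite /U_ -(conj_esym_sigma hp hzeta hL hp_odd _ ck).
  rewrite rmorphD /= -Exi -[bar zeta zeta]/(sigma (-1) zeta) -galM ?memvf //.
  rewrite (gal_commute (sigma (-1))) galM ?memvf // -Exi.
  exact: (reduces_to_conj_esym hp hzeta M_gt1 _ (hbar _ _ xc)).
rewrite rmorphD /= /bar -galM ?memvf // (sigmaN1K hp hzeta hL) gal_id.
by rewrite addrC.
Qed.

End CongruenceToEsym.

(** * The cycle of implications *)

Theorem theorem3p4 (p n A w M : nat)
  (hp : prime p) (hp_odd : odd p) (hn : (1 <= n)%N)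
  (hM : M = (A * p ^ n + w)%N)
  (hA : (0 < A < p ^ n)%N) (hw : (0 < w < p ^ n)%N)
  (hw1 : (w ^ p.-1 = 1 %[mod p ^ n])%N)
  (L : splittingFieldType rat) (zeta : L)
  (hzeta : p.-primitive_root zeta) (hL : <<1; zeta>>%VS = fullv)
  (pi : Zring zeta)
  (hpi : exists u v : Zring zeta, u * pi + v * M%:R = 1)
  (hsymb : exists2 s : Zring zeta,
     power_residue p (principal_ideal M%:R) pi s & s != 1)
  (f : nat) (hf : f.-primitive_root (M%:R : 'F_p))
  (S : seq int) (hS : gamma_reps zeta p M f S)
  (hdiv : forall x : nat, (1 < x < p ^ n)%N ->
     (x ^ p.-1 = 1 %[mod p ^ n])%N -> ~~ (x %| M)%N) :
  [<-> prime M;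
       exists2 xi : L, p.-primitive_root xi &
         congr_mod zeta M (tau p n M f S pi ^+ (p ^ n.-1)) xi;
       forall m : nat, (1 <= m <= p.-1 %/ 2)%N ->
         congr_mod zeta M (T_ p n M f S pi n.-1 m) (U_ zeta p m)].

Proof.
have [u [v huv]] := hpi.
have M_gt1 : (1 < M)%N.
  rewrite hM; case/andP: hA => A0 _; case/andP: hw => w0 _.
  have pn0 : (0 < p ^ n)%N by rewrite expn_gt0 prime_gt0.
  by have := muln_gt0 A (p ^ n); rewrite A0 pn0; lia.
(* [M] is congruent to [w] modulo [p ^ n]. *)
have hM1 : (M ^ p.-1 = 1 %[mod p ^ n])%N.
  by rewrite -modnXm hM modnMDl modnXm.
have cS : all (fun i => coprimez i p%:Z) S.
  by move: hS; rewrite /gamma_reps; case: ifP => _ [].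
tfae.
- by move=> prM; exact: (prime_congruence hp hzeta hL hp_odd hn hf huv hS prM hM1 hsymb).
- by case=> xi xip cxi m _; apply: (congruence_esym hp hzeta hL hp_odd M_gt1 m xip cxi).
(* The order argument is applied to the least prime factor, whose square is at most [M] when [M] is
   composite. *)
move=> hTU; have prq := pdiv_prime M_gt1.
have := prime_divisor_order hp hzeta hL hp_odd hn huv hf cS prq (pdiv_dvd M) hTU.
move=> hq; apply: contraT => nprM.
have q2 : (pdiv M ^ 2 <= M)%N by rewrite leqNgt; apply: contra nprM; apply: ltn_pdiv2_prime; apply: ltnW.
(* From [A <= p ^ n - 1] and [w < p ^ n] follows [M < p ^ (2 n)]; the least prime factor is then an
   [x] excluded by [hdiv]. *)
have ltq : (pdiv M < p ^ n)%N.
  rewrite -(ltn_exp2r _ _ (isT : (0 < 2)%N)); apply: leq_ltn_trans q2 _.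
  case/andP: hA => _ A1; case/andP: hw => _ w1; rewrite hM expnS expn1.
  move: (p ^ n)%N A1 w1 => P; nia.
have := hdiv (pdiv M); rewrite prime_gt1 //= ltq => /(_ isT hq).
by rewrite pdiv_dvd.
Qed.
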